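(* Let $f,K'\in\mathbb{R}[x,y,z]$ and $\beta,\gamma\in\mathbb{R}$, put $K=K'z$ with $\deg f,\deg K\leq 2$, and let $\chi=(P,Q,R)$ be the cubic vector field on $\mathbb{T}^2$ given by $$P=\tfrac14 Kx+fy+\beta z,\qquad Q=\tfrac14 Ky-fx+\gamma z,$$ $$R=\tfrac12 K'\big(-a^2(x^2+y^2)+z^2+a^4-1\big)-2(\beta x+\gamma y)(x^2+y^2-a^2).$$ Suppose that $\chi$ has (exactly) four invariant meridians, the number being counted with multiplicities. Then the invariant meridians are limit cycles if and only if $K'=0$ has no solution on those meridians. Moreover, the limit cycles appear as stable or unstable alternately.
   Context: Fix a real number $a>1$ and let $\mathbb{T}^2=\{(x,y,z)\in\mathbb{R}^3:(x^2+y^2-a^2)^2+z^2-1=0\}$. A triple $\chi=(P,Q,R)$ with $P,Q,R\in\mathbb{R}[x,y,z]$ denotes the polynomial vector field $P\frac{\partial}{\partial x}+Q\frac{\partial}{\partial y}+R\frac{\partial}{\partial z}$ in $\mathbb{R}^3$, acting on polynomials as a derivation; its degree is $\max\{\deg P,\deg Q,\deg R\}$, and it is cubic if its degree is $3$. An algebraic surface $\{g=0\}$ is invariant for $\chi$ if $\chi g=Lg$ for some $L\in\mathbb{R}[x,y,z]$; $\chi$ is a vector field on $\mathbb{T}^2$ if $\{(x^2+y^2-a^2)^2+z^2-1=0\}$ is invariant in this sense. A meridian plane is a plane $\{\lambda x+\mu y=0\}$ containing the $z$-axis, with $(\lambda,\mu)\in\mathbb{R}^2\setminus\{(0,0)\}$;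 its intersection with $\mathbb{T}^2$ consists of a pair of closed curves, called meridians. A meridian is invariant if its meridian plane is invariant for $\chi$. The multiplicity of an invariant meridian plane $\{\lambda x+\mu y=0\}$ is the largest positive integer $k$ such that $(\lambda x+\mu y)^k$ divides the extactic polynomial $xQ-yP$ of $\chi$ associated with the span of $x$ and $y$ if this polynomial is non-zero, and is infinite otherwise; numbers of invariant meridians are counted taking these multiplicities into account (each plane giving a pair of meridians). A limit cycle is a periodic orbit that is isolated in the set of all periodic orbits of the vector field $\chi$ on $\mathbb{T}^2$.
   Formalization: If the four invariant meridians are two of multiplicity two, their limit cycles are semi-stable, so the alternation fails literally; it is read there as one-sided: each double meridian is stable from one side and unstable from the other, the sides alternating. *)

(* Defs.v *)
From HB Require Import structures.
From mathcomp Require Import all_boot all_order all_algebra.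
From mathcomp Require Import all_classical all_reals all_analysis.
From mathcomp Require mpoly.
(* The notations of mpoly clash with those of MathComp-Analysis: the ring
   R[x, y, z] is written [mpoly 3 R] instead of {mpoly R[3]}. *)
Export -(notations) mpoly.
Import Order.TTheory GRing.Theory Num.Theory numFieldNormedType.Exports.
Set Implicit Arguments.
Unset Strict Implicit.
Unset Printing Implicit Defensive.
Local Open Scope classical_set_scope.
Local Open Scope ring_scope.

Definition ix : 'I_3 := ord0.
Definition iy : 'I_3 := Ordinal (isT : (1 < 3)%N).
Definition iz : 'I_3 := Ordinal (isT : (2 < 3)%N).

Section Polynomials.
Variable R : realType.
Implicit Types (g h : mpoly 3 R) (chi : 3.-tuple (mpoly 3 R)).

Definition vx : mpoly 3 R := mpolyX R (mnm1 ix).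
Definition vy : mpoly 3 R := mpolyX R (mnm1 iy).
Definition vz : mpoly 3 R := mpolyX R (mnm1 iz).

Definition peval g (p : 'rV[R]_3) : R := meval (p 0) g.

(* [msize] is 1 + the total degree, and 0 for the zero polynomial. *)
Definition pdegree g : nat := (msize g).-1.

Definition pdvd h g : Prop := exists q, g = q * h.

Definition apply_field chi g : mpoly 3 R :=
  \sum_(i < 3) tnth chi i * mderiv i g.

Definition field_degree chi : nat := \max_(i < 3) pdegree (tnth chi i).

Definition invariant_surface chi g : Prop :=
  exists L, apply_field chi g = L * g.

Definition torus_poly (a : R) : mpoly 3 R :=
  (vx ^+ 2 + vy ^+ 2 - mpolyC 3 (a ^+ 2)) ^+ 2 + vz ^+ 2 - 1.

Definition torus (a : R) : set 'rV[R]_3 := [set p | peval (torus_poly a) p = 0].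

Definition field_on_torus (a : R) chi : Prop :=
  invariant_surface chi (torus_poly a).

Definition extactic chi : mpoly 3 R := vx * tnth chi iy - vy * tnth chi ix.

Definition plane_form (lambda mu : R) : mpoly 3 R := lambda *: vx + mu *: vy.

(* [k] is the (finite) multiplicity of the plane as an invariant meridian
   plane; there is no such [k] when the extactic polynomial vanishes. *)
Definition plane_multiplicity chi (lambda mu : R) (k : nat) : Prop :=
  [/\ extactic chi <> 0, (0 < k)%N, pdvd (plane_form lambda mu ^+ k) (extactic chi)
    & forall j, pdvd (plane_form lambda mu ^+ j) (extactic chi) -> (j <= k)%N].

(* The meridian plane through the direction (cos theta, sin theta, 0).  It
   meets the torus in the two meridians of angles theta and theta + pi. *)
Definition angle_form (theta : R) : mpoly 3 R :=
  plane_form (- sin theta) (cos theta).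

(* As a > 1, the torus does not meet the z-axis. *)
Definition meridian (a theta : R) : set 'rV[R]_3 :=
  [set p | torus a p /\
    exists2 r, 0 < r & p 0 ix = r * cos theta /\ p 0 iy = r * sin theta].

Definition invariant_meridian chi (theta : R) : Prop :=
  invariant_surface chi (angle_form theta).

(* [ts] lists the angles of all invariant meridians in [0, 2 pi[, in cyclic
   order around the z-axis, each one repeated according to its multiplicity.
   Such a list is unique, and exists if and only if the number of invariant
   meridians counted with multiplicities is finite; its size is that number. *)
Definition lists_invariant_meridians chi (ts : seq R) : Prop :=
  [/\ sorted <=%R ts,
      forall theta, theta \in ts <->
        0 <= theta < 2 * pi /\ invariant_meridian chi theta
    & forall theta, theta \in ts ->
        plane_multiplicity chi (- sin theta) (cos theta) (count_mem theta ts)].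

End Polynomials.

Section Dynamics.
Variable R : realType.
Implicit Types (a theta : R) (chi : 3.-tuple (mpoly 3 R)).
Implicit Types (c : R -> 'rV[R]_3) (Gamma D U V : set 'rV[R]_3).

(* The torus being compact, the solutions on it are defined for all times. *)
Definition trajectory a chi c : Prop :=
  (forall t, torus a (c t)) /\
  (forall t : R, is_derive t (1 : R) c (\row_i peval (tnth chi i) (c t))).

Definition periodic_orbit a chi Gamma : Prop :=
  exists c T, [/\ trajectory a chi c, 0 < T, (forall t, c (t + T) = c t),
                  (exists t, c t <> c 0) & Gamma = range c].

Definition limit_cycle a chi Gamma : Prop :=
  periodic_orbit a chi Gamma /\
  exists U, [/\ open U, Gamma `<=` U &
    forall Gamma', periodic_orbit a chi Gamma' ->
      Gamma' `&` U !=set0 -> Gamma' = Gamma].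

Definition omega_limit c : set 'rV[R]_3 := cluster (c @ +oo).
Definition alpha_limit c : set 'rV[R]_3 := cluster (c @ -oo).

(* Asymptotic orbital stability with respect to the initial conditions in
   the region [D]; the usual (two-sided) notion is the case [D = setT]. *)
Definition stable_within a chi D Gamma : Prop :=
  forall V, open V -> Gamma `<=` V ->
  exists U, [/\ open U, Gamma `<=` U &
    forall c, trajectory a chi c -> (U `&` D) (c 0) ->
      (forall t, 0 <= t -> V (c t)) /\ omega_limit c = Gamma].

Definition unstable_within a chi D Gamma : Prop :=
  forall V, open V -> Gamma `<=` V ->
  exists U, [/\ open U, Gamma `<=` U &
    forall c, trajectory a chi c -> (U `&` D) (c 0) ->
      (forall t, t <= 0 -> V (c t)) /\ alpha_limit c = Gamma].

(* The region seen by the i-th entry of a list of meridians with repetitions: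
   the whole space if this entry is not repeated.  If it is, the first copy
   sees the points just before the meridian (for increasing angles, that is
   with angle_form <= 0), the last copy sees those just after it, and the
   intermediate copies only the meridian itself. *)
Definition entry_region (ts : seq R) (i : nat) : set 'rV[R]_3 :=
  let theta := nth 0 ts i in
  [set p | (theta \in take i ts -> 0 <= peval (angle_form theta) p) /\
           (theta \in drop i.+1 ts -> peval (angle_form theta) p <= 0)].

(* The entries of [ts] (of even length, so that this is meaningful cyclically)
   are labelled stable and unstable in turn.  A meridian of multiplicity 1 has
   to be a stable or an unstable limit cycle as labelled.  A meridian of
   multiplicity 2 carries two consecutive, hence opposite, labels, one for each
   of its sides: it is a semi-stable limit cycle. *)
Definition alternately_stable a chi (ts : seq R) : Prop :=
  ~~ odd (size ts) /\
  exists b : bool, forall i, (i < size ts)%N ->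
    let Gamma := meridian a (nth 0 ts i) in
    limit_cycle a chi Gamma ->
    if b (+) odd i then stable_within a chi (entry_region ts i) Gamma
    else unstable_within a chi (entry_region ts i) Gamma.

End Dynamics.

(* Main.v *)
Require Import Defs.
From HB Require Import structures.
From mathcomp Require Import all_boot all_order all_algebra.
From mathcomp Require Import all_classical all_reals all_analysis.
From mathcomp Require Import ring lra.
Import Order.TTheory GRing.Theory Num.Theory numFieldNormedType.Exports.
Set Implicit Arguments.
Unset Strict Implicit.
Unset Printing Implicit Defensive.
Local Open Scope classical_set_scope.
Local Open Scope ring_scope.

(* A plane of angle theta is invariant if and only if f vanishes on it and
   gamma cos theta = beta sin theta.  Four invariant meridians, counted with
   multiplicities, come either from two distinct planes or from one plane of
   multiplicity two; in both cases beta = gamma = 0 and f = c l1 l2, where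
   l1 and l2 are the (possibly equal) linear forms of the planes and c <> 0.
   With x^2 + y^2 = a^2 + cos phi and z = sin phi on the torus, the angle theta
   around the z-axis and phi then satisfy
     theta' = - f,   phi' = - K' (x^2 + y^2) / 2.
   Between two consecutive invariant meridians f has a constant sign, so theta
   is strictly monotone there and the invariant meridians are the only possible
   periodic orbits.  An invariant meridian is one exactly when phi' does not
   vanish on it, since a zero of K' on it is an equilibrium.  In that case the
   nearby solutions on a side wind around it while theta tends to it in the
   future or in the past, according to the sign of f on that side, and this
   sign alternates. *)

(** * Calculus on the line *)

(** No existence or uniqueness theorem for systems of differential equations is used. Invariance
    always comes from a scalar equation [g' = q g], whose solutions vanish identically or keep their
    sign, and existence is only needed on a meridian, where the system reduces to one autonomous
    equation for phi. The angle theta is never lifted to the line. Each meridian gets rotated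
    coordinates [l] (across its plane) and [m] (along it), in which f is [l * (al * l + be * m)],
    and the monotone quantity is the cosine [m / r], where [r ^ 2 = l ^ 2 + m ^ 2]. A simple
    meridian has [be != 0] and the sign of [be] decides its stability on both sides; a double one
    has [be = 0], and then the sign of [al] tells the attracting side from the repelling one.
    Instability is stability after time reversal. *)

Section Calculus.
Variable R : realType.
Implicit Types (f g : R -> R) (t : R).

Lemma der_cst (c t : R) : is_derive t 1 (fun=> c) 0.
Proof. exact: is_derive_cst. Qed.

Lemma der_id t : is_derive t 1 (fun s : R => s) 1.
Proof. exact: is_derive_id. Qed.

Lemma derD f g t df dg : is_derive t 1 f df -> is_derive t 1 g dg ->
  is_derive t 1 (fun s => f s + g s) (df + dg).
Proof. exact: is_deriveD. Qed.

Lemma derN f t df : is_derive t 1 f df -> is_derive t 1 (fun s => - f s) (- df).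
Proof. exact: is_deriveN. Qed.

Lemma derM f g t df dg : is_derive t 1 f df -> is_derive t 1 g dg ->
  is_derive t 1 (fun s => f s * g s) (df * g t + f t * dg).
Proof.
move=> hf hg; apply: is_derive_eq.
by rewrite /GRing.scale /= addrC mulrC.
Qed.

Lemma derX f t df n : is_derive t 1 f df ->
  is_derive t 1 (fun s => f s ^+ n) (n%:R * f t ^+ n.-1 * df).
Proof.
case: n => [|n] hf.
  apply: (is_derive_eq (der_cst 1 t)); by rewrite !mul0r.
have -> : (fun s => f s ^+ n.+1) = f ^+ n.+1 by apply/funext => s; rewrite fctE.
apply: is_derive_eq.
by rewrite -[_ *: _]/(_ * _) -mulr_natl; ring.
Qed.

Lemma derV f t df : f t != 0 -> is_derive t 1 f df ->
  is_derive t 1 (fun s => (f s)^-1) (- df / f t ^+ 2).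
Proof.
move=> f0 hf; apply: (is_derive_eq (is_deriveV f0 hf)).
by rewrite /GRing.scale /= mulrC mulrN mulNr.
Qed.

Lemma der_comp g f t df dg : is_derive (f t) 1 g dg -> is_derive t 1 f df ->
  is_derive t 1 (fun s => g (f s)) (dg * df).
Proof. exact: is_derive1_comp. Qed.

Lemma der_continuous f t df : is_derive t 1 f df -> {for t, continuous f}.
Proof. by move=> ?; exact/differentiable_continuous/derivable1_diffP. Qed.

Lemma der_eq0_cst f : (forall t, is_derive t 1 f 0) -> forall x y, f x = f y.
Proof. by move=> h x y; exact: is_derive_0_is_cst. Qed.

Lemma MVT_le f df x y : x <= y ->
  (forall t, x <= t -> t <= y -> is_derive t 1 f (df t)) ->
  exists c, [/\ x <= c, c <= y & f y - f x = df c * (y - x)].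
Proof.
move=> xy h.
have [|t +|c] := @MVT_segment R f df x y xy.
- by move=> t; rewrite in_itv /= => /andP[/ltW ? /ltW ?]; exact: h.
- apply: (@continuous_in_subspaceT _ _ `[x, y]%classic f) => z.
  rewrite inE /= in_itv /= => /andP[? ?]; exact: (der_continuous (h _ _ _)).
by rewrite in_itv /= => /andP[? ?] ?; exists c.
Qed.

End Calculus.

(** * Primitives of continuous functions on the whole line *)

Section Primitive.
Variable R : realType.
Implicit Types (f g q : R -> R) (t u : R).

(** The hypotheses are confined to [|u| <= |t|], because the primitives to be compared are first
    known on bounded segments only. *)
Lemma der_unique f g q t : f 0 = g 0 ->
  (forall u : R, `|u| <= `|t| -> is_derive u 1 f (q u)) ->
  (forall u : R, `|u| <= `|t| -> is_derive u 1 g (q u)) -> f t = g t.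
Proof.
move=> fg0 hf hg.
have hd (u : R) : `|u| <= `|t| -> is_derive u 1 (fun s => f s - g s) 0.
  move=> ut; have -> : 0 = q u - q u by lra.
  exact: derD (hf u ut) (derN (hg u ut)).
case: (leP 0 t) => [t0|/ltW t0].
  have [u u0 ut|c [_ _]] :=
    @MVT_le R (fun s => f s - g s) (fun=> 0) 0 t t0 _; last by move=> /= ?; lra.
  by apply: hd; rewrite !ger0_norm.
have [u u0 ut|c [_ _]] :=
  @MVT_le R (fun s => f s - g s) (fun=> 0) t 0 t0 _; last by move=> /= ?; lra.
by apply: hd; rewrite !ler0_norm// lerN2.
Qed.

Lemma primitive_on_segment q (k : R) : continuous q -> 0 < k ->
  exists Q, Q 0 = 0 /\ forall t : R, `|t| < k -> is_derive t 1 Q (q t).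
Proof.
move=> cq k0.
(* The integral starts at [- k] so that negative arguments are covered as well; subtracting [F 0]
   then normalises the primitive at 0. *)
pose F x := (\int[lebesgue_measure]_(t in [set` `[- k, x]]) (q t))%R.
exists (fun x => F x - F 0); split; first by rewrite subrr.
move=> t; rewrite ltr_norml => /andP[tk1 tk2].
have [] := @continuous_FTC1_closed R q (- k) t k tk2 _ tk1 (cq t).
  apply: continuous_compact_integrable; first exact: segment_compact.
  exact: continuous_subspaceT.
move=> dF F'; have hF : is_derive t 1 F (q t).
  by apply: DeriveDef; [exact: dF|rewrite -derive1E; exact: F'].
by apply: (is_derive_eq (derD hF (derN (der_cst (F 0) t)))); rewrite oppr0 addr0.
Qed.

(* The primitives on segments that vanish at 0 agree on their overlaps. *)
Lemma primitive q : continuous q ->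
  exists Q, Q 0 = 0 /\ forall t, is_derive t 1 Q (q t).
Proof.
move=> cq.
have /choice[G hG] : forall n : nat, exists Q : R -> R, Q 0 = 0 /\
    forall t : R, `|t| < n.+1%:R -> is_derive t 1 Q (q t).
  by move=> n; apply: primitive_on_segment.
have lt_truncS (t : R) : `|t| < (Num.truncn `|t|).+1%:R.
  by have /andP[] := truncn_itv (normr_ge0 t).
exists (fun t => G (Num.truncn `|t|) t).
split=> [|t]; first exact: (hG (Num.truncn `|0 : R|)).1.
have [G0 dG] := hG (Num.truncn `|t|).
(* The index of the glued function may jump near [t], so it is compared there with one fixed
   primitive, valid on a neighbourhood of [t]. *)
apply: (@near_eq_is_derive _ _ _ (G (Num.truncn `|t|))); last exact: dG.
have : \forall s \near t, `|s| < (Num.truncn `|t|).+1%:R.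
  exact: (cvgr_lt `|t| (@norm_continuous _ _ t)).
apply: filterS => s sn; have [G0' dG'] := hG (Num.truncn `|s|).
apply: (@der_unique _ _ q); first by rewrite G0 G0'.
- by move=> u us; apply: dG; exact: le_lt_trans us sn.
- by move=> u us; apply: dG'; exact: le_lt_trans us (lt_truncS s).
Qed.

End Primitive.

(** * Scalar differential equations *)

Section ScalarODE.
Variable R : realType.
Implicit Types (f g q : R -> R) (s t u x y : R).

Lemma IVT_le f x y v : continuous f -> x <= y -> f x <= v <= f y ->
  exists c, [/\ x <= c, c <= y & f c = v].
Proof.
move=> cf xy /andP[h1 h2].
have [|c] := @IVT R f x y v xy (@continuous_subspaceT _ _ _ _ cf).
  by rewrite ge_min h1 le_max h2 orbT.
by rewrite in_itv /= => /andP[? ?] ?; exists c.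
Qed.

(** For a primitive [Q] of [q], the product [g * exp (- Q)] is constant. What matters later is only
    that the factor [E] is positive. *)
Lemma linear_ode_solution g q : continuous q ->
  (forall t, is_derive t 1 g (q t * g t)) ->
  exists E : R -> R, forall t, 0 < E t /\ g t = g 0 * E t.
Proof.
move=> cq dg; have [Q [Q0 dQ]] := primitive cq.
exists (fun t => expR (Q t)) => t; split; first exact: expR_gt0.
have dh s : is_derive s 1 (fun s => g s * expR (- Q s)) 0.
  apply: (is_derive_eq (derM (dg s) (der_comp (is_derive_expR _) (derN (dQ s))))).
  by ring.
have := der_eq0_cst dh t 0; rewrite /= Q0 oppr0 expR0 mulr1 => <-.
by rewrite -mulrA -expRD addNr expR0 mulr1.
Qed.

Lemma circle_angle x y : x ^+ 2 + y ^+ 2 = 1 ->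
  exists psi, [/\ - pi <= psi <= pi, x = cos psi & y = sin psi].
Proof.
move=> h; have hx : -1 <= x <= 1 by apply/andP; split; nra.
have cx : cos (acos x) = x by rewrite acosK// in_itv.
have sx : sin (acos x) = `|y| by rewrite sin_acos// -h addrC addKr sqrtr_sqr.
have a0 := acos_ge0 hx; have api := acos_lepi hx.
have [y0|/ltW y0] := leP 0 y.
  by exists (acos x); rewrite cx sx ger0_norm//; split => //; lra.
exists (- acos x); rewrite cosN sinN cx sx ler0_norm// opprK; split => //; lra.
Qed.

(** [phi] is obtained by integrating the angular velocity. The scalar product of [(rho, z)] with
    [(cos phi, sin phi)] has derivative 0 and equals 1 at time 0; two unit vectors with scalar
    product 1 coincide. *)
Lemma circle_lift (rho z w : R -> R) : continuous w ->
  (forall t, is_derive t 1 rho (- z t * w t)) ->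
  (forall t, is_derive t 1 z (rho t * w t)) ->
  (forall t, rho t ^+ 2 + z t ^+ 2 = 1) ->
  exists phi : R -> R, (forall t, is_derive t 1 phi (w t)) /\
    (forall t, rho t = cos (phi t) /\ z t = sin (phi t)).
Proof.
move=> cw drho dz h1.
have [psi [_ rho0 z0]] := circle_angle (h1 0); have [W [W0 dW]] := primitive cw.
pose phi t := psi + W t.
have dphi t : is_derive t 1 phi (w t).
  by apply: (is_derive_eq (derD (der_cst psi t) (dW t))); rewrite add0r.
exists phi; split => // t.
have dk s : is_derive s 1 (fun s => rho s * cos (phi s) + z s * sin (phi s)) 0.
  apply: (is_derive_eq (derD (derM (drho s) (der_comp (is_derive_cos _) (dphi s)))
                             (derM (dz s) (der_comp (is_derive_sin _) (dphi s))))).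
  by ring.
have := der_eq0_cst dk t 0.
rewrite /= [phi 0]/phi W0 addr0 -rho0 -z0 -!expr2 h1.
have := h1 t; have := cos2Dsin2 (phi t) => hc hr hd.
have e : (rho t - cos (phi t)) ^+ 2 + (z t - sin (phi t)) ^+ 2 = 0 by nra.
move/eqP: e; rewrite paddr_eq0 ?sqr_ge0// !sqrf_eq0 !subr_eq0.
by move=> /andP[/eqP -> /eqP ->].
Qed.

(** Separation of variables: [H], the primitive of [1 / F], is the time needed to reach a point, and
    [phi] is its inverse. The bound [B] makes [H] grow at least like [x / B], hence onto; the time
    [S] is [H T], as [F] is [T]-periodic. *)
Lemma positive_field_flow (F : R -> R) (T B : R) : 0 < T -> continuous F ->
  (forall x, 0 < F x) -> (forall x, F x <= B) -> (forall x, F (x + T) = F x) ->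
  exists phi : R -> R, exists2 S : R, 0 < S &
    [/\ forall t, is_derive t 1 phi (F (phi t)), forall x, exists t, phi t = x
      & forall t, phi (t + S) = phi t + T].
Proof.
move=> T0 cF F0 FB FT.
have cV : continuous (fun x => (F x)^-1).
  by move=> x; apply: continuousV (cF x); rewrite gt_eqF.
have [H [H0 dH]] := primitive cV.
have cH : continuous H by move=> x; exact: der_continuous (dH x).
have B0 : 0 < B := lt_le_trans (F0 0) (FB 0).
have grow x y : x <= y -> (y - x) / B <= H y - H x.
  move=> xy; have [c [_ _ ->]] := @MVT_le R H _ x y xy (fun t _ _ => dH t).
  by rewrite mulrC ler_wpM2r ?subr_ge0// lef_pV2 ?posrE.
have inc x y : x < y -> H x < H y.
  move=> xy; have := grow _ _ (ltW xy); have : 0 < (y - x) / B.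
    by rewrite divr_gt0// subr_gt0.
  lra.
have injH x y : H x = H y -> x = y.
  by move=> e; case: (ltgtP x y) => // /inc; rewrite e ltxx.
have surj v : exists x, H x = v.
  have [v0|/ltW v0] := leP 0 v.
    have := grow 0 (v * B); rewrite subr0 H0 subr0 mulfK ?gt_eqF//.
    move=> /(_ (mulr_ge0 v0 (ltW B0))) h.
    have [|c [_ _ <-]] := @IVT_le H 0 (v * B) v cH (mulr_ge0 v0 (ltW B0)).
      by rewrite H0 v0 h.
    by exists c.
  have vB : v * B <= 0 by rewrite mulr_le0_ge0// ltW.
  have := grow (v * B) 0 vB; rewrite H0 !sub0r mulNr mulfK ?gt_eqF// => h.
  have [|c [_ _ <-]] := @IVT_le H (v * B) 0 v cH vB; last by exists c.
  by rewrite H0 v0; lra.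
have /choice[phi phiK] : forall v, exists x, H x = v by [].
have HK x : phi (H x) = x by apply: injH; rewrite phiK.
have dHT x : is_derive x 1 (fun x => H (x + T) - H x) 0.
  apply: (is_derive_eq (derD (@der_comp _ H (fun x => x + T) x _ _ (dH _)
    (derD (der_id x) (der_cst T x))) (derN (dH x)))).
  by rewrite FT; ring.
exists phi, (H T); first by rewrite -H0; exact: inc.
split=> [t|x|t].
- rewrite -{1}[t]phiK -[F _]invrK; apply: (@is_derive_inverse _ H).
  + by near=> x; exact: HK.
  + by near=> x; exact: cH.
  + by rewrite invr_eq0 gt_eqF.
- by exists (H x); rewrite HK.
- apply: injH; rewrite phiK.
  have := der_eq0_cst dHT (phi t) 0; rewrite /= add0r H0 phiK; lra.
Unshelve. all: by end_near. Qed.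

(** By the intermediate value theorem [F] has a constant sign; the negative case is the positive one
    run backwards. *)
Lemma periodic_field_flow (F : R -> R) (B : R) : continuous F ->
  (forall x, F x != 0) -> (forall x, `|F x| <= B) ->
  (forall x, F (x + 2 * pi) = F x) ->
  exists phi : R -> R, exists2 S : R, 0 < S &
    [/\ forall t, is_derive t 1 phi (F (phi t)), forall x, exists t, phi t = x
      & forall t, cos (phi (t + S)) = cos (phi t) /\
                  sin (phi (t + S)) = sin (phi t)].
Proof.
move=> cF F0 FB FT; have pi2 : 0 < 2 * pi :> R by rewrite mulr_gt0// pi_gt0.
have per x : cos (x + 2 * pi) = cos x :> R /\ sin (x + 2 * pi) = sin x :> R.
  by rewrite mulr_natl cosD2pi sinD2pi.
have sgn x y : 0 < F x -> F y < 0 -> False.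
  move=> Fx Fy; have [xy|/ltW yx] := leP x y.
    have cN : continuous (fun x => - F x) by move=> u; exact: continuousN (cF u).
    have [|c [_ _ /eqP]] := @IVT_le (fun x => - F x) x y 0 cN xy.
      by lra.
    by rewrite oppr_eq0 (negbTE (F0 c)).
  have [|c [_ _ /eqP]] := @IVT_le F y x 0 cF yx; first by lra.
  by rewrite (negbTE (F0 c)).
case: (ltgtP (F 0) 0) => [Fneg|Fpos|/eqP]; last by rewrite (negbTE (F0 0)).
- have F_neg x : F x < 0.
    by case: (ltgtP (F x) 0) => // [/sgn/(_ Fneg)//|/eqP]; rewrite (negbTE (F0 x)).
  have [|u|u|u|phi [S S0 [h1 h2 h3]]] :=
    @positive_field_flow (fun x => - F x) (2 * pi) B pi2.
  + by move=> u; exact: continuousN (cF u).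
  + by rewrite oppr_gt0.
  + by have := FB u; rewrite ler_norml; lra.
  + by rewrite FT.
  exists (fun t => phi (- t)), S => //; split=> [t|x|t].
  + apply: (is_derive_eq (der_comp (h1 (- t)) (derN (der_id t)))); ring.
  + by have [t <-] := h2 x; exists (- t); rewrite opprK.
  + have := h3 (- (t + S)); rewrite opprD subrK => ->.
    by have [-> ->] := per (phi (- t - S)).
- have F_pos x : 0 < F x.
    by case: (ltgtP (F x) 0) => // [/(sgn _ _ Fpos)//|/eqP]; rewrite (negbTE (F0 x)).
  have [u|phi [S S0 [h1 h2 h3]]] :=
    @positive_field_flow F (2 * pi) B pi2 cF F_pos _ FT.
    exact: le_trans (ler_norm _) (FB u).
  exists phi, S => //; split=> // t; rewrite h3; exact: per.
Qed.

End ScalarODE.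

(** * The equations in a rotated frame *)

Section Continuity.
Variables (R : realType) (T : topologicalType).
Implicit Types f g : T -> R.

Lemma cont_add f g : continuous f -> continuous g ->
  continuous (fun t => f t + g t).
Proof. by move=> cf cg t; exact: continuousD (cf t) (cg t). Qed.

Lemma cont_mul f g : continuous f -> continuous g ->
  continuous (fun t => f t * g t).
Proof. by move=> cf cg t; exact: continuousM (cf t) (cg t). Qed.

Lemma cont_opp f : continuous f -> continuous (fun t => - f t).
Proof. by move=> cf t; exact: continuousN (cf t). Qed.

Lemma cont_exp f n : continuous f -> continuous (fun t => f t ^+ n).
Proof.
by move=> cf t; exact: continuous_comp (cf t) (@exprn_continuous _ n (f t)).
Qed.

Lemma cont_inv f : (forall t, f t != 0) -> continuous f ->
  continuous (fun t => (f t)^-1).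
Proof. by move=> f0 cf t; exact: continuousV (f0 t) (cf t). Qed.

Lemma cont_sqrt f : continuous f -> continuous (fun t => Num.sqrt (f t)).
Proof. by move=> cf t; exact: continuous_comp (cf t) (@sqrt_continuous R (f t)). Qed.

Lemma cont_cst (c : R) : continuous ((fun=> c) : T -> R).
Proof. by move=> t; exact: cst_continuous. Qed.

End Continuity.

(** Separated from [cont] so that it can be extended once the frame coordinates exist. *)
Ltac cont_leaf := assumption.
Ltac cont := repeat lazymatch goal with
  | |- forall _, @continuous_at _ _ _ (fun _ => ?c) => exact: cont_cst
  | |- forall _, @continuous_at _ _ _ (fun t => @?f t + @?g t) =>
      apply: (@cont_add _ _ f g)
  | |- forall _, @continuous_at _ _ _ (fun t => - @?f t) => apply: (@cont_opp _ _ f)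
  | |- forall _, @continuous_at _ _ _ (fun t => @?f t * @?g t) =>
      apply: (@cont_mul _ _ f g)
  | |- forall _, @continuous_at _ _ _ (fun t => @?f t ^+ ?n) =>
      apply: (@cont_exp _ _ f n)
  | |- forall _, @continuous_at _ _ _ (fun t => Num.sqrt (@?f t)) =>
      apply: (@cont_sqrt _ _ f)
  | |- _ => cont_leaf
  end.

(** * Attraction towards the half plane of a meridian *)

Section ReducedSystem.
Variable R : realType.
Implicit Types (a al be t : R) (l m z k : R -> R).

(* The field in the frame of a meridian plane [l = 0] where f is
   [l * (al * l + be * m)]; [k] is the value of K' along the solution. *)
Record reduced a al be l m z k : Prop := Reduced {
  reduced_factor : continuous k;
  reduced_l : forall t, is_derive t 1 l
    (k t * z t / 4 * l t - l t * (al * l t + be * m t) * m t);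
  reduced_m : forall t, is_derive t 1 m
    (k t * z t / 4 * m t + l t ^+ 2 * (al * l t + be * m t));
  reduced_z : forall t, is_derive t 1 z
    (- k t / 2 * (l t ^+ 2 + m t ^+ 2 - a ^+ 2) * (l t ^+ 2 + m t ^+ 2));
  reduced_torus : forall t, (l t ^+ 2 + m t ^+ 2 - a ^+ 2) ^+ 2 + z t ^+ 2 = 1 }.

Section Solution.
Variables (a al be : R) (l m z k : R -> R).
Hypotheses (a1 : 1 < a) (sol : reduced a al be l m z k).
Let h t := al * l t + be * m t.
Let r2 t := l t ^+ 2 + m t ^+ 2.

Let ck : continuous k := reduced_factor sol.
Let dl t := reduced_l sol t.
Let dm t := reduced_m sol t.
Let dz t := reduced_z sol t.
Let cl : continuous l. Proof. by move=> t; exact: der_continuous (dl t). Qed.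
Let cm : continuous m. Proof. by move=> t; exact: der_continuous (dm t). Qed.
Let cz : continuous z. Proof. by move=> t; exact: der_continuous (dz t). Qed.

Lemma reduced_r2_bounds t : a ^+ 2 - 1 <= r2 t <= a ^+ 2 + 1.
Proof.
have := reduced_torus sol t; rewrite -/(r2 t) => e.
have : `|r2 t - a ^+ 2| <= 1.
  rewrite -ler_sqr ?nnegrE// real_normK ?num_real// expr1n -e.
  by rewrite lerDl sqr_ge0.
by rewrite ler_norml; lra.
Qed.

Lemma reduced_a2_gt0 : 0 < a ^+ 2 - 1. Proof. by rewrite subr_gt0 exprn_egt1. Qed.

Lemma reduced_r2_gt0 t : 0 < r2 t.
Proof. have := reduced_r2_bounds t; have := reduced_a2_gt0; lra. Qed.

Lemma reduced_l_sign : exists E : R -> R, forall t, 0 < E t /\ l t = l 0 * E t.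
Proof.
apply: (@linear_ode_solution _ l (fun t => k t * z t / 4 - h t * m t)).
  by rewrite /h; cont.
by move=> t; apply: (is_derive_eq (dl t)); rewrite /h; ring.
Qed.

(** [h] is the other linear factor of f, so its plane is invariant for the same reason as
    [l = 0]. *)
Lemma reduced_h_sign : exists E : R -> R, forall t, 0 < E t /\ h t = h 0 * E t.
Proof.
apply: (@linear_ode_solution _ h
  (fun t => k t * z t / 4 + l t * (be * l t - al * m t))).
  by cont.
move=> t; apply: (is_derive_eq (derD (derM (der_cst al t) (dl t))
  (derM (der_cst be t) (dm t)))); rewrite /h; ring.
Qed.

(** The cosine of the angle to the half plane [l = 0 < m]. The terms in [k * z] act radially and
    cancel, which leaves an expression with the sign of [h]. *)
Lemma reduced_cosine t :
  is_derive t 1 (fun t => m t / Num.sqrt (r2 t)) (l t ^+ 2 * h t / Num.sqrt (r2 t)).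
Proof.
have r0 := reduced_r2_gt0 t.
have s0 : Num.sqrt (r2 t) != 0 by rewrite gt_eqF// sqrtr_gt0.
have dr := derD (derX 2 (dl t)) (derX 2 (dm t)).
have ds := @der_comp _ Num.sqrt r2 t _ _ (is_derive1_sqrt r0) dr.
apply: (is_derive_eq (derM (dm t) (@derV _ (fun s => Num.sqrt (r2 s)) t _ s0 ds))) => /=.
set dr2 := 2 * l t ^+ 1 * _ + _.
have -> : dr2 = k t * z t / 2 * Num.sqrt (r2 t) ^+ 2.
  by rewrite sqr_sqrtr ?ltW// /dr2 /r2; field.
by move: s0; rewrite /h; set s := Num.sqrt _ => s0; field.
Qed.

Lemma reduced_cosine_le1 t : m t / Num.sqrt (r2 t) <= 1.
Proof.
have r0 := reduced_r2_gt0 t.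
rewrite ler_pdivrMr ?sqrtr_gt0// mul1r.
apply: (le_trans (ler_norm _)); rewrite -sqrtr_sqr; apply: ler_wsqrtr.
by rewrite /r2 lerDr sqr_ge0.
Qed.

(** The cosine returns to its value, so [l ^ 2 * h] vanishes at some intermediate time; the factor
    that vanishes there vanishes at time 0 too. *)
Lemma reduced_periodic T : 0 < T -> l T = l 0 -> m T = m 0 ->
  l 0 = 0 \/ h 0 = 0.
Proof.
move=> T0 lT mT.
have [|l0] := eqVneq (l 0) 0; first by left.
have [|h0] := eqVneq (h 0) 0; first by right.
have [E hE] := reduced_l_sign; have [H hH] := reduced_h_sign.
have [c [_ _ /= ]] := MVT_le (ltW T0) (fun t _ _ => reduced_cosine t).
rewrite {1 2}/r2 lT mT subrr subr0 => /esym/eqP; rewrite !mulf_eq0.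
have [Ec ->] := hE c; have [Hc ->] := hH c.
rewrite invr_eq0 !mulf_eq0 (negbTE l0) (negbTE h0) !gt_eqF ?sqrtr_gt0//.
exact: reduced_r2_gt0.
Qed.

(* Near [l = 0 < m], the ratio [|l| / m] is the tangent of the angle to the
   half plane, and it can only decrease as long as [h >= 0]. *)
Lemma reduced_trapped s t d : (forall u, 0 <= h u) -> s <= t -> 0 < m s ->
  `|l s| <= d * m s -> 0 < m t /\ `|l t| <= d * m t.
Proof.
move=> h0 st ms ls.
have [c [_ _ /= e]] := MVT_le st (fun t _ _ => reduced_cosine t).
have rs := reduced_r2_gt0 s; have rt := reduced_r2_gt0 t.
have : m s / Num.sqrt (r2 s) <= m t / Num.sqrt (r2 t).
  rewrite -subr_ge0 e mulr_ge0 ?subr_ge0// mulr_ge0// ?invr_ge0 ?sqrtr_ge0//.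
  by rewrite mulr_ge0 ?sqr_ge0.
move=> le.
have ns : 0 < m s / Num.sqrt (r2 s) by rewrite divr_gt0// sqrtr_gt0.
have mt : 0 < m t.
  by have := lt_le_trans ns le; rewrite pmulr_lgt0// invr_gt0 sqrtr_gt0.
split => //.
have d0 : 0 <= d.
  by have := le_trans (normr_ge0 _) ls; rewrite pmulr_lge0.
rewrite -ler_sqr ?nnegrE ?normr_ge0 ?mulr_ge0 ?(ltW mt)//.
have {}le : m s ^+ 2 / r2 s <= m t ^+ 2 / r2 t.
  rewrite -(sqr_sqrtr (ltW rs)) -(sqr_sqrtr (ltW rt)) -!exprVn -!exprMn.
  by rewrite ler_sqr ?nnegrE ?(ltW ns)// (le_trans (ltW ns)).
have : `|l s| ^+ 2 <= (d * m s) ^+ 2.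
  by rewrite ler_sqr ?nnegrE ?normr_ge0 ?mulr_ge0 ?(ltW ms).
rewrite !real_normK ?num_real// => ls2.
move: le; rewrite ler_pdivrMr// mulrAC ler_pdivlMr// /r2 => le.
have e1 : m s ^+ 2 * l t ^+ 2 <= m t ^+ 2 * l s ^+ 2 by lra.
have e2 : m t ^+ 2 * l s ^+ 2 <= m t ^+ 2 * (d * m s) ^+ 2.
  by rewrite ler_wpM2l ?sqr_ge0.
rewrite -(ler_pM2l (exprn_gt0 2 ms)); apply: (le_trans e1); apply: (le_trans e2).
by rewrite !exprMn; lra.
Qed.

(** Either alternative makes [h] nonnegative at time 0, hence always, so the cosine never decreases
    and the wedge [|l| <= d * m] traps the solution. If [|l| / m] did not tend to 0, the cosine
    would increase at a speed bounded below and exceed 1. *)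
Lemma reduced_attracted d : 0 < m 0 -> `|l 0| <= d * m 0 ->
  (0 < be /\ `|al| * d <= be / 2) \/ [/\ be = 0, al != 0 & 0 <= al * l 0] ->
  (forall t, 0 <= t -> 0 < m t /\ `|l t| <= d * m t) /\
  (forall e, 0 < e -> exists T, forall t, T <= t -> `|l t| <= e * m t).
Proof.
move=> m0 l0 hyp.
have hge t : 0 < m t -> `|l t| <= d * m t -> 0 < be -> `|al| * d <= be / 2 ->
    be / 2 * m t <= h t.
  move=> mt lt b0 ad.
  have h1 : `|al * l t| <= be / 2 * m t.
    rewrite normrM; apply: (le_trans (ler_wpM2l (normr_ge0 _) lt)).
    by rewrite mulrA ler_pM2r.
  by move: h1; rewrite ler_norml /h => /andP[h1 _]; lra.
have h_ge0 u : 0 <= h u.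
  have [H hH] := reduced_h_sign; have [Hu ->] := hH u.
  rewrite pmulr_lge0//; case: hyp => [[b0 ad]|[b0 _ lge]].
    by apply: le_trans (hge _ m0 l0 b0 ad); rewrite mulr_ge0 ?ltW ?divr_gt0.
  by rewrite /h b0 mul0r addr0.
have trap t : 0 <= t -> 0 < m t /\ `|l t| <= d * m t.
  by move=> t0; exact: (@reduced_trapped 0 t d).
split => // e e0; apply: contrapT => /forallNP nT.
(* A narrower wedge is trapping as well: entering it once would already give the required [T]. *)
have far t : 0 <= t -> e * m t < `|l t|.
  move=> t0; rewrite ltNge; apply/negP => le; apply: (nT t) => u tu.
  by have [] := @reduced_trapped t u e h_ge0 tu (trap t t0).1 le.
(* Lower bound of [m ^ 2], from [a ^ 2 - 1 <= r2 <= (1 + d ^ 2) * m ^ 2] in the wedge. *)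
pose M := (a ^+ 2 - 1) / (1 + d ^+ 2).
have D0 : 0 < 1 + d ^+ 2 by rewrite ltr_pwDl ?sqr_ge0.
have M0 : 0 < M by rewrite divr_gt0 ?reduced_a2_gt0.
have mM t : 0 <= t -> M <= m t ^+ 2.
  move=> t0; have [mt lt] := trap t t0.
  rewrite ler_pdivrMr//; have /andP[+ _] := reduced_r2_bounds t.
  have : l t ^+ 2 <= (d * m t) ^+ 2.
    rewrite -[l t ^+ 2]real_normK ?num_real// ler_sqr ?nnegrE//.
    exact: le_trans (normr_ge0 _) lt.
  by rewrite exprMn /r2; lra.
have lM t : 0 <= t -> e ^+ 2 * M <= l t ^+ 2.
  move=> t0; have [mt _] := trap t t0.
  apply: (@le_trans _ _ ((e * m t) ^+ 2)).
    by rewrite exprMn ler_wpM2l ?sqr_ge0// mM.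
  rewrite -[l t ^+ 2]real_normK ?num_real// ler_sqr ?nnegrE ?normr_ge0//.
    exact: ltW (far t t0).
  by rewrite mulr_ge0 ?ltW.
have [N N0 hN] : exists2 N, 0 < N & forall t, 0 <= t -> N <= h t ^+ 2.
  case: hyp => [[b0 ad]|[b0 al0 _]].
    exists ((be / 2) ^+ 2 * M); first by rewrite mulr_gt0// exprn_gt0// divr_gt0.
    move=> t t0.
    have [mt lt] := trap t t0; apply: (@le_trans _ _ ((be / 2 * m t) ^+ 2)).
      by rewrite [leRHS]exprMn ler_wpM2l ?sqr_ge0// mM.
    by rewrite ler_sqr ?nnegrE ?hge// mulr_ge0 ?ltW// divr_gt0.
  exists (al ^+ 2 * (e ^+ 2 * M)).
    by rewrite mulr_gt0 ?exprn_even_gt0// mulr_gt0// exprn_gt0.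
  move=> t t0.
  by rewrite /h b0 mul0r addr0 exprMn ler_wpM2l ?sqr_ge0// lM.
(* Lower bound of the squared speed of the cosine, from [l ^ 2 >= e ^ 2 * M], [h ^ 2 >= N] and
   [r2 <= a ^ 2 + 1]. *)
pose C := (e ^+ 2 * M) ^+ 2 * N / (a ^+ 2 + 1).
have C0 : 0 < C.
  rewrite divr_gt0//; last by have := reduced_a2_gt0; lra.
  by rewrite mulr_gt0// exprn_gt0// mulr_gt0// exprn_gt0.
have S0 : 0 < Num.sqrt C by rewrite sqrtr_gt0.
have speed t : 0 <= t -> Num.sqrt C <= l t ^+ 2 * h t / Num.sqrt (r2 t).
  move=> t0; have r0 := reduced_r2_gt0 t.
  have n0 : 0 <= l t ^+ 2 * h t / Num.sqrt (r2 t).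
    by rewrite mulr_ge0 ?invr_ge0 ?sqrtr_ge0// mulr_ge0 ?sqr_ge0.
  rewrite -[leRHS]ger0_norm// -sqrtr_sqr; apply: ler_wsqrtr.
  have -> : (l t ^+ 2 * h t / Num.sqrt (r2 t)) ^+ 2
      = (l t ^+ 2) ^+ 2 * h t ^+ 2 / r2 t.
    by rewrite exprMn exprVn sqr_sqrtr ?ltW// exprMn.
  have eM : 0 <= e ^+ 2 * M by rewrite mulr_ge0 ?sqr_ge0// ltW.
  apply: ler_pM.
  - by rewrite mulr_ge0 ?sqr_ge0 ?(ltW N0).
  - by rewrite invr_ge0; have := reduced_a2_gt0; lra.
  - by rewrite ler_pM ?sqr_ge0 ?(ltW N0) ?hN// ler_sqr ?nnegrE ?sqr_ge0 ?lM.
  - rewrite lef_pV2 ?posrE//; last by have := reduced_a2_gt0; lra.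
    by have /andP[] := reduced_r2_bounds t.
(* By this time the cosine would have gained 2, starting from a positive value. *)
have T0 : 0 <= 2 / Num.sqrt C by rewrite divr_ge0 ?sqrtr_ge0.
have [c [c0 _ /= E]] := MVT_le T0 (fun t _ _ => reduced_cosine t).
have := ler_wpM2r T0 (speed c c0).
rewrite mulrC divfK ?gt_eqF// -[2 / _]subr0 -E.
have := reduced_cosine_le1 (2 / Num.sqrt C).
have : 0 < m 0 / Num.sqrt (r2 0) by rewrite divr_gt0// sqrtr_gt0 reduced_r2_gt0.
lra.
Qed.

Lemma reduced_angle_lift : exists phi : R -> R,
  (forall t, is_derive t 1 phi (- k t / 2 * r2 t)) /\
  (forall t, r2 t - a ^+ 2 = cos (phi t) /\ z t = sin (phi t)).
Proof.
apply: circle_lift.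
- by rewrite /r2; cont.
- by move=> t; apply: (is_derive_eq (derD (derD (derX 2 (dl t)) (derX 2 (dm t)))
    (derN (der_cst (a ^+ 2) t)))); rewrite /r2 /=; field.
- by move=> t; apply: (is_derive_eq (dz t)); rewrite /r2; ring.
- exact: reduced_torus sol.
Qed.

End Solution.
End ReducedSystem.

(** * Winding around the generating circle *)

Section Winding.
Variable R : realType.
Implicit Types (a al be t : R) (l m z k phi w : R -> R).

Lemma winding_pos phi w c T psi : 0 < c ->
  (forall t, is_derive t 1 phi (w t)) -> (forall t, T <= t -> c <= w t) ->
  exists t, [/\ T <= t, cos (phi t) = cos psi & sin (phi t) = sin psi].
Proof.
move=> c0 dphi cw; have pi2 : 0 < 2 * pi :> R by rewrite mulr_gt0// pi_gt0.
have cphi : continuous phi by move=> t; exact: der_continuous (dphi t).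
(* Enough turns for the target [psi + 2 pi n] to lie beyond [phi T]; growth at rate [c] reaches it
   before [t1]. *)
pose n := Num.bound `|(phi T - psi) / (2 * pi)|.
have hn : phi T <= psi + (2 * pi) *+ n.
  rewrite -mulr_natr -lerBlDl mulrC -ler_pdivrMr//.
  apply: le_trans (ler_norm _) _.
  by apply: ltW; exact: archi_boundP (normr_ge0 _).
pose t1 := T + (psi + (2 * pi) *+ n - phi T) / c.
have Tt1 : T <= t1 by rewrite lerDl divr_ge0 ?subr_ge0// ltW.
have [u [Tu _ e]] := MVT_le Tt1 (fun t _ _ => dphi t).
have ht1 : psi + (2 * pi) *+ n <= phi t1.
  rewrite -(lerD2r (- phi T)) e /t1 (addrC T) addrK [leRHS]mulrC -mulrA ler_peMr//.
    by rewrite subr_ge0.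
  by rewrite mulrC ler_pdivlMr// mul1r cw.
have [|t [Tt _ et]] := @IVT_le R phi T t1 (psi + (2 * pi) *+ n) cphi Tt1.
  by apply/andP; split; [exact: hn|exact: ht1].
exists t; split => //; rewrite et mulr_natl.
  by rewrite (periodicn (@cosD2pi R)).
by rewrite (periodicn (@sinD2pi R)).
Qed.

Lemma winding phi w c (b : bool) T psi : 0 < c ->
  (forall t, is_derive t 1 phi (w t)) ->
  (forall t, T <= t -> c <= (-1) ^+ b * w t) ->
  exists t, [/\ T <= t, cos (phi t) = cos psi & sin (phi t) = sin psi].
Proof.
case: b => c0 dphi cw; last first.
  apply: (@winding_pos phi w c T psi c0 dphi) => t /cw.
  by rewrite expr0 mul1r.
have [t /cw|t [Tt ec es]] := @winding_pos (fun t => - phi t)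
  (fun t => - w t) c T (- psi) c0 (fun t => derN (dphi t)).
  by rewrite expr1 mulN1r.
exists t; split=> //; first by move: ec; rewrite !cosN.
by apply: oppr_inj; move: es; rewrite !sinN.
Qed.

Lemma reduced_winding a al be l m z k e (b : bool) T psi : 1 < a ->
  reduced a al be l m z k -> 0 < e ->
  (forall t, T <= t -> e <= (-1) ^+ b * k t) ->
  exists t, [/\ T <= t, l t ^+ 2 + m t ^+ 2 - a ^+ 2 = cos psi & z t = sin psi].
Proof.
move=> a1 sol e0 ke; have [phi [dphi hphi]] := reduced_angle_lift sol.
(* The sign is negated because [phi] has velocity [- k / 2 * r2]; the rate uses
   [r2 >= a ^ 2 - 1]. *)
have [|t Tt|t [Tt ec es]] := @winding phi _ (e / 2 * (a ^+ 2 - 1)) (~~ b) T psi _ dphi.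
- by rewrite mulr_gt0 ?divr_gt0// (reduced_a2_gt0 a1).
- have /andP[hr _] := reduced_r2_bounds sol t.
  rewrite signrN.
  rewrite [leRHS](_ : _ = ((-1) ^+ b * k t / 2) * (l t ^+ 2 + m t ^+ 2)); last by ring.
  apply: ler_pM => //; rewrite ?divr_ge0 ?(ltW e0) ?(ltW (reduced_a2_gt0 a1))//.
  by rewrite ler_pM2r// ke.
by have [hc hs] := hphi t; exists t; rewrite hc hs ec es.
Qed.

(** Changing the signs of f and K' reverses time within the same family of systems, which reduces
    repulsion to attraction. *)
Lemma reduced_reverse a al be l m z k : reduced a al be l m z k ->
  reduced a (- al) (- be) (fun t => l (- t)) (fun t => m (- t))
    (fun t => z (- t)) (fun t => - k (- t)).
Proof.
case=> ck dl dm dz h; have dN t := derN (der_id t).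
split=> [|t|t|t|t] //.
- move=> t; apply: continuousN.
  exact: (continuous_comp (@continuousN _ _ _ id t (@cvg_id _ _)) (ck (- t))).
- by apply: (is_derive_eq (der_comp (dl (- t)) (dN t))); field.
- by apply: (is_derive_eq (der_comp (dm (- t)) (dN t))); field.
- by apply: (is_derive_eq (der_comp (dz (- t)) (dN t))); field.
Qed.

(* On the plane [l = 0] all components are multiples of the affine factor,
   which therefore satisfies a linear equation along the solution. *)
Lemma reduced_equilibrium a al be l m z k (k0 k1 k2 k3 : R) t0 :
  reduced a al be l m z k ->
  (forall t, k t = k0 + k1 * l t + k2 * m t + k3 * z t) ->
  l t0 = 0 -> k t0 = 0 -> forall t, [/\ l t = l 0, m t = m 0 & z t = z 0].
Proof.
move=> sol kE lt0 kt0; have [ck dl dm dz h] := sol.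
have cl : continuous l by move=> t; exact: der_continuous (dl t).
have cm : continuous m by move=> t; exact: der_continuous (dm t).
have cz : continuous z by move=> t; exact: der_continuous (dz t).
have [E hE] := reduced_l_sign sol.
have l0 t : l t = 0.
  have [_ ->] := hE t; have [Et0 /eqP] := hE t0.
  by rewrite lt0 eq_sym mulf_eq0 (gt_eqF Et0) orbF => /eqP ->; rewrite mul0r.
pose q t := k2 * (z t / 4 * m t)
  + k3 * (- (m t ^+ 2 - a ^+ 2) * m t ^+ 2 / 2).
have [|t|H hH] := @linear_ode_solution R k q; first by rewrite /q; cont.
  have -> : k = (fun t => k0 + k1 * l t + k2 * m t + k3 * z t) by apply/funext.
  apply: (is_derive_eq (derD (derD (derD (der_cst k0 t) (derM (der_cst k1 t)
    (dl t))) (derM (der_cst k2 t) (dm t))) (derM (der_cst k3 t) (dz t)))).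
  by rewrite -kE l0 /q; field.
have k_0 t : k t = 0.
  have [_ ->] := hH t; have [Ht0 /eqP] := hH t0.
  by rewrite kt0 eq_sym mulf_eq0 (gt_eqF Ht0) orbF => /eqP ->; rewrite mul0r.
move=> t; split; first by rewrite !l0.
- apply: der_eq0_cst => u; apply: (is_derive_eq (dm u)).
  by rewrite k_0 l0; ring.
- apply: der_eq0_cst => u; apply: (is_derive_eq (dz u)).
  by rewrite k_0; field.
Qed.

(** With [m ^ 2 = a ^ 2 + cos phi] and [z = sin phi], the system on [l = 0] amounts to the single
    equation [phi' = F phi], whose right-hand side has no zero. *)
Lemma meridian_flow a al be (k0 k2 k3 : R) : 1 < a ->
  let m psi := Num.sqrt (a ^+ 2 + cos psi) in
  let kap psi := k0 + k2 * m psi + k3 * sin psi in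
  (forall psi, kap psi != 0) ->
  exists phi : R -> R, exists2 S : R, 0 < S &
    [/\ reduced a al be (fun=> 0) (fun t => m (phi t)) (fun t => sin (phi t))
          (fun t => kap (phi t)),
        forall psi, exists t, phi t = psi
      & forall t, cos (phi (t + S)) = cos (phi t) /\
                  sin (phi (t + S)) = sin (phi t)].
Proof.
move=> a1 m kap kap0.
have a21 : 1 < a ^+ 2 by rewrite exprn_egt1.
have r0 psi : 0 < a ^+ 2 + cos psi.
  by have := cos_geN1 psi; lra.
have sm psi : m psi ^+ 2 = a ^+ 2 + cos psi by rewrite sqr_sqrtr// ltW.
have m0 psi : 0 < m psi by rewrite sqrtr_gt0.
have cc := @continuous_cos R; have cs := @continuous_sin R.
have cm : continuous m by apply: cont_sqrt; cont.
have ckap : continuous kap by rewrite /kap; cont.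
pose F psi := - kap psi / 2 * (a ^+ 2 + cos psi).
have per x : cos (x + 2 * pi) = cos x :> R /\ sin (x + 2 * pi) = sin x :> R.
  by rewrite mulr_natl cosD2pi sinD2pi.
have m_le psi : m psi <= a ^+ 2 + 1.
  have := sm psi; have := m0 psi; have := a21.
  by have := cos_le1 psi; nra.
pose B := (`|k0| + `|k2| * (a ^+ 2 + 1) + `|k3|) / 2 * (a ^+ 2 + 1).
have [|psi|psi|psi|phi [S S0 [dphi sphi pphi]]] := @periodic_field_flow R F B.
- by rewrite /F; cont.
- by rewrite /F !mulf_neq0// ?oppr_eq0// gt_eqF.
- rewrite /F /B !normrM normrN normfV normr_nat (ger0_norm (ltW (r0 psi))).
  apply: ler_pM; first by rewrite divr_ge0.
  - exact: ltW (r0 _).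
  - rewrite ler_pM2r ?invr_gt0//.
    apply: (le_trans (ler_normD _ _)); apply: lerD.
      apply: (le_trans (ler_normD _ _)); rewrite lerD2l normrM.
      by rewrite ler_wpM2l// ger0_norm ?m_le// ltW.
    by rewrite normrM ler_piMr// sin_max.
  - by rewrite lerD2l cos_le1.
- by rewrite /F /kap /m; have [-> ->] := per psi.
exists phi, S => //; split => //; split.
- move=> t; apply: continuous_comp; last exact: ckap.
  exact: der_continuous (dphi t).
- move=> t; apply: (is_derive_eq (der_cst 0 t)); ring.
- move=> t.
  have dcos := der_comp (is_derive_cos _) (dphi t).
  have dr := derD (der_cst (a ^+ 2) t) dcos.
  apply: (is_derive_eq (@der_comp _ Num.sqrt _ t _ _ (is_derive1_sqrt (r0 (phi t))) dr)).
  rewrite -/(m (phi t)) /F -sm; field.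
  by rewrite gt_eqF.
- move=> t; apply: (is_derive_eq (der_comp (is_derive_sin _) (dphi t))).
  by rewrite sm /F; field.
- by move=> t; rewrite sm expr0n add0r [_ + cos _]addrC addrK cos2Dsin2.
Qed.

End Winding.

(** * Geometry of the torus around a meridian *)

Section Frame.
Variable R : realType.
Implicit Types (a theta x y z : R) (p : 'rV[R]_3).

(* Coordinates of [p] across and along the half plane of angle [theta]. *)
Definition lc theta p := - sin theta * p 0 ix + cos theta * p 0 iy.
Definition mc theta p := cos theta * p 0 ix + sin theta * p 0 iy.

Definition pt theta (l m z : R) : 'rV[R]_3 :=
  \row_i nth 0 [:: m * cos theta - l * sin theta;
                   m * sin theta + l * cos theta; z] i.

Lemma ord3P (i : 'I_3) : [\/ i = ix, i = iy | i = iz].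
Proof.
case: i => [[|[|[|//]]] h]; [constructor 1|constructor 2|constructor 3];
  exact: val_inj.
Qed.

Lemma ptx theta l m z : pt theta l m z 0 ix = m * cos theta - l * sin theta.
Proof. by rewrite mxE. Qed.
Lemma pty theta l m z : pt theta l m z 0 iy = m * sin theta + l * cos theta.
Proof. by rewrite mxE. Qed.
Lemma ptz theta l m z : pt theta l m z 0 iz = z.
Proof. by rewrite mxE. Qed.

Lemma coord_x theta p : p 0 ix = mc theta p * cos theta - lc theta p * sin theta.
Proof.
have h := cos2Dsin2 theta.
rewrite /mc /lc -[LHS]mul1r -h; ring.
Qed.

Lemma coord_y theta p : p 0 iy = mc theta p * sin theta + lc theta p * cos theta.
Proof.
have h := cos2Dsin2 theta.
rewrite /mc /lc -[LHS]mul1r -h; ring.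
Qed.

Lemma pt_coords theta p : pt theta (lc theta p) (mc theta p) (p 0 iz) = p.
Proof.
apply/rowP => i; case: (ord3P i) => ->; rewrite ?ptx ?pty ?ptz //.
- by rewrite -coord_x.
- by rewrite -coord_y.
Qed.

Lemma lc_pt theta l m z : lc theta (pt theta l m z) = l.
Proof.
have h := cos2Dsin2 theta.
by rewrite /lc ptx pty -[RHS]mul1r -h; ring.
Qed.

Lemma mc_pt theta l m z : mc theta (pt theta l m z) = m.
Proof.
have h := cos2Dsin2 theta.
by rewrite /mc ptx pty -[RHS]mul1r -h; ring.
Qed.

Lemma sqr_coords theta p :
  lc theta p ^+ 2 + mc theta p ^+ 2 = p 0 ix ^+ 2 + p 0 iy ^+ 2.
Proof.
have h := cos2Dsin2 theta.
by rewrite /lc /mc -[RHS]mul1r -h; ring.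
Qed.

Lemma torusE a theta p : torus a p <->
  (lc theta p ^+ 2 + mc theta p ^+ 2 - a ^+ 2) ^+ 2 + p 0 iz ^+ 2 = 1.
Proof.
rewrite sqr_coords /torus /= /peval /torus_poly /vx /vy /vz.
rewrite !(mevalB, mevalD, mevalM, mevalXU, mevalC, meval1, expr2).
by split=> h; [apply/eqP; rewrite -subr_eq0; apply/eqP|]; lra.
Qed.

Lemma meridianE a theta p : meridian a theta p <->
  [/\ torus a p, lc theta p = 0 & 0 < mc theta p].
Proof.
split=> [[tp [r r0 [px py]]]|[tp l0 m0]].
  have h := cos2Dsin2 theta.
  split=> //; rewrite ?/lc ?/mc px py; first by ring.
  by have -> : cos theta * (r * cos theta) + sin theta * (r * sin theta) = r
    by rewrite -[RHS]mul1r -h; ring.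
split => //; exists (mc theta p) => //.
by rewrite {1}(coord_x theta p) {1}(coord_y theta p) l0 !mul0r subr0 addr0.
Qed.

Lemma coord_cont (i : 'I_3) : continuous (fun p => p 0 i).
Proof. exact: coord_continuous. Qed.

Lemma lc_cont theta : continuous (lc theta).
Proof. by rewrite /lc; cont; exact: coord_cont. Qed.

Lemma mc_cont theta : continuous (mc theta).
Proof. by rewrite /mc; cont; exact: coord_cont. Qed.

Lemma row_cont (T : topologicalType) (f : T -> 'rV[R]_3) :
  (forall i, continuous (fun t => f t 0 i)) -> continuous f.
Proof.
move=> cf t; apply/cvg_ballP => e e0.
have : \forall s \near t, forall i, ball (f t 0 i) e (f s 0 i).
  by apply: filter_forall => i; have /cvg_ballP := cf i t; apply.
by apply: filterS => s h; split=> // i j; rewrite (ord1 i).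
Qed.

(* The point of the torus of angle [psi] on the generating circle, where the
   ratio of the two coordinates [lc] and [mc] is [w]. *)
Definition tube theta a (wpsi : R * R) : 'rV[R]_3 :=
  let m := Num.sqrt ((a ^+ 2 + cos wpsi.2) / (1 + wpsi.1 ^+ 2)) in
  pt theta (wpsi.1 * m) m (sin wpsi.2).


Section Tube.
Variables (a theta : R).
Hypothesis a1 : 1 < a.

Let r0 psi : 0 < a ^+ 2 + cos psi.
Proof.
have a21 : 1 < a ^+ 2 by rewrite exprn_egt1.
by have := cos_geN1 psi; lra.
Qed.

Let D0 w : 0 < 1 + w ^+ 2 :> R.
Proof. by rewrite ltr_pwDl ?sqr_ge0. Qed.

Lemma tube_cont : continuous (tube theta a).
Proof.
apply: row_cont => i.
have c1 : continuous (fun wpsi : R * R => wpsi.1) by move=> ?; exact: cvg_fst.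
have c2 : continuous (fun wpsi : R * R => wpsi.2) by move=> ?; exact: cvg_snd.
have cc : continuous (fun wpsi : R * R => cos wpsi.2).
  by move=> x; exact: continuous_comp (c2 x) (@continuous_cos R _).
have cs : continuous (fun wpsi : R * R => sin wpsi.2).
  by move=> x; exact: continuous_comp (c2 x) (@continuous_sin R _).
pose m (wpsi : R * R) := Num.sqrt ((a ^+ 2 + cos wpsi.2) / (1 + wpsi.1 ^+ 2)).
have cm : continuous m.
  rewrite /m; cont; apply: cont_inv; last by cont.
  by move=> t; rewrite gt_eqF.
case: (ord3P i) => ->.
- have -> : (fun t => tube theta a t 0 ix) =
      (fun t => m t * cos theta - t.1 * m t * sin theta).
    by apply/funext => t; exact: ptx.
  by cont.
- have -> : (fun t => tube theta a t 0 iy) =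
      (fun t => m t * sin theta + t.1 * m t * cos theta).
    by apply/funext => t; exact: pty.
  by cont.
- have -> : (fun t => tube theta a t 0 iz) = (fun t => sin t.2).
    by apply/funext => t; exact: ptz.
  by cont.
Qed.

(** With ratio [w], one has [(1 + w ^ 2) * m ^ 2 = a ^ 2 + cos psi], and [mc theta p] is the
    positive root. *)
Lemma tubeK p psi : 0 < mc theta p ->
  lc theta p ^+ 2 + mc theta p ^+ 2 - a ^+ 2 = cos psi -> p 0 iz = sin psi ->
  tube theta a (lc theta p / mc theta p, psi) = p.
Proof.
move=> m0 hc hs; rewrite -[RHS](pt_coords theta) /tube /= -hs.
have -> : Num.sqrt ((a ^+ 2 + cos psi) / (1 + (lc theta p / mc theta p) ^+ 2))
    = mc theta p.
  rewrite -hc -[RHS]gtr0_norm// -sqrtr_sqr; congr Num.sqrt.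
  apply/(mulIf (lt0r_neq0 (D0 (lc theta p / mc theta p)))).
  rewrite divfK ?gt_eqF//; field; exact: lt0r_neq0.
by rewrite divfK ?gt_eqF.
Qed.

Lemma tube0_meridian psi : meridian a theta (tube theta a (0, psi)).
Proof.
have s0 : 0 < Num.sqrt ((a ^+ 2 + cos psi) / (1 + 0 ^+ 2)).
  by rewrite sqrtr_gt0 divr_gt0.
apply/meridianE; split; rewrite ?lc_pt ?mc_pt ?mul0r//.
rewrite (torusE a theta) lc_pt mc_pt ptz.
rewrite sqr_sqrtr ?divr_ge0 ?(ltW (r0 _)) ?(ltW (D0 _))//=.
rewrite expr0n addr0 divr1 mul0r expr0n add0r addrAC subrr add0r.
exact: cos2Dsin2.
Qed.

Lemma torus_angle p : torus a p -> exists psi, [/\ - pi <= psi <= pi,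
  lc theta p ^+ 2 + mc theta p ^+ 2 - a ^+ 2 = cos psi & p 0 iz = sin psi].
Proof. by move/(torusE a theta)/circle_angle. Qed.

(** A tube lemma: compactness of [[- pi, pi]] makes the admissible ratio uniform in the angle. It
    replaces neighbourhoods by wedges, the shape that attracted solutions cannot leave. *)
Lemma meridian_tube_nbhs (V : set 'rV[R]_3) : open V ->
  meridian a theta `<=` V -> exists2 d, 0 < d & forall p, torus a p ->
    0 < mc theta p -> `|lc theta p| <= d * mc theta p -> V p.
Proof.
move=> oV sV.
have cpt : compact `[- pi, pi : R] by exact: segment_compact.
have /compact_near_coveringP := cpt.
move=> /(_ R (nbhs (0 : R)) (fun w psi => V (tube theta a (w, psi)))).
case => [psi _|e /= e0 h].
  have := @tube_cont (0, psi) V (open_nbhs_nbhs (conj oV (sV _ (tube0_meridian psi)))).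
  case=> /= -[A B] [/= hA hB] AB.
  exists (B, A) => //= -[y w] /= [By Aw]; exact: (AB (w, y)).
exists (e / 2); first by rewrite divr_gt0.
move=> p tp m0 lp; have [psi [hpsi hc hs]] := torus_angle tp.
rewrite -(tubeK m0 hc hs); apply: h; last by rewrite /= in_itv.
rewrite /ball_ /= sub0r normrN normrM normfV (gtr0_norm m0).
rewrite ltr_pdivrMr//; apply: (le_lt_trans lp); rewrite ltr_pM2r//.
by rewrite gtr_pMr// invf_lt1// ltr1n.
Qed.

End Tube.

End Frame.

Ltac cont_leaf ::=
  first [assumption | exact: lc_cont | exact: mc_cont | exact: coord_cont].

(** * Dynamics near a meridian *)

Section Meridian.
Variable R : realType.
Variables (a theta : R).
Hypothesis a1 : 1 < a.
Implicit Types (p : 'rV[R]_3) (c : R -> 'rV[R]_3) (al be : R).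
Let Gamma := meridian a theta.

Definition in_frame al be (kap : 'rV[R]_3 -> R) c :=
  reduced a al be (fun t => lc theta (c t)) (fun t => mc theta (c t))
    (fun t => c t 0 iz) (fun t => kap (c t)).

(** The meridian is the image of a segment: compactness bounds [|kap|] below and connectedness fixes
    its sign. *)
Lemma factor_sign (kap : 'rV[R]_3 -> R) : continuous kap ->
  (forall p, Gamma p -> kap p <> 0) ->
  exists b : bool, exists2 k0, 0 < k0 &
    forall p, Gamma p -> k0 <= (-1) ^+ b * kap p.
Proof.
move=> ckap kap0; pose g (psi : R) := kap (tube theta a (0, psi)).
have cg : continuous g.
  move=> psi; apply: (@continuous_comp _ _ _ (fun psi : R => tube theta a (0, psi)) kap);
    last exact: ckap.
  apply: (@continuous_comp _ _ _ (fun psi : R => ((0 : R), psi)) (tube theta a)).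
    exact: (cvg_pair (cvg_cst (0 : R)) (@cvg_id _ (nbhs psi))).
  exact: tube_cont.
have g0 psi : g psi != 0 by apply/eqP/kap0/tube0_meridian.
have npi : - pi <= pi :> R by have := @pi_gt0 R; lra.
have [psi0 _ hmin] := @EVT_min R (fun psi => `|g psi|) _ _ npi
  (@continuous_subspaceT _ _ _ _ (fun psi => continuous_comp (cg psi)
    (@norm_continuous _ _ (g psi)))).
have sgn x y : 0 < g x -> g y < 0 -> False.
  move=> gx gy; have [xy|/ltW yx] := leP x y.
    have [|u [_ _ /eqP]] := @IVT_le R (fun x => - g x) x y 0 (cont_opp cg) xy.
      by rewrite oppr_le0 oppr_ge0 !ltW.
    by rewrite oppr_eq0 (negbTE (g0 u)).
  have [|u [_ _ /eqP]] := @IVT_le R g y x 0 cg yx; first by rewrite !ltW.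
  by rewrite (negbTE (g0 u)).
exists (g 0 < 0), `|g psi0|; first by rewrite normr_gt0.
move=> p Gp; have [tp l0 m0] := (meridianE a theta p).1 Gp.
have [psi [hpsi hc hs]] := torus_angle theta tp.
have gp : g psi = kap p.
  by rewrite /g -[in RHS](tubeK m0 hc hs) l0 mul0r.
rewrite -gp; apply: (@le_trans _ _ `|g psi|); first by apply: hmin; rewrite in_itv.
case: (ltgtP (g 0) 0) => g00.
- have gpsi : g psi < 0.
    rewrite ltNge le_eqVlt eq_sym (negbTE (g0 psi)) /=.
    by apply/negP => h; exact: sgn h g00.
  by rewrite expr1 mulN1r ltr0_norm.
- have gpsi : 0 < g psi.
    by rewrite ltNge le_eqVlt (negbTE (g0 psi)) /=; apply/negP => h; exact: sgn g00 h.
  by rewrite expr0 mul1r gtr0_norm.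
- by move/eqP: g00; rewrite (negbTE (g0 0)).
Qed.

Lemma in_frame_torus al be kap c : in_frame al be kap c ->
  forall t, torus a (c t).
Proof. by move=> sol t; apply/(torusE a theta); exact: reduced_torus sol t. Qed.

Lemma cluster_le c (g : 'rV[R]_3 -> R) p T : continuous g ->
  (forall t, T <= t -> g (c t) <= 0) -> cluster (c @ +oo) p -> g p <= 0.
Proof.
move=> cg gT clp; rewrite leNgt; apply/negP => gp.
have [||q [/= Aq Bq]] := clp [set q | g q <= 0] [set q | 0 < g q].
- exists T; split; first exact: num_real.
  by move=> t /ltW; exact: gT.
- exact: (cvgr_gt (g p) (cg p)).
by move: Bq; rewrite ltNge Aq.
Qed.

(* A solution trapped in a neighbourhood of the meridian tends to it and winds
   around it for ever, as [kap] does not vanish there. *)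
Lemma attracting al be (kap : 'rV[R]_3 -> R) (V : set 'rV[R]_3) :
  continuous kap -> (forall p, Gamma p -> kap p <> 0) ->
  0 < be \/ be = 0 /\ al != 0 -> open V -> Gamma `<=` V ->
  exists U, [/\ open U, Gamma `<=` U & forall c, in_frame al be kap c ->
    U (c 0) -> (be = 0 -> 0 <= al * lc theta (c 0)) ->
    (forall t, 0 <= t -> V (c t)) /\ cluster (c @ +oo) = Gamma].
Proof.
move=> ckap kap0 albe oV sV.
have [b [k0 k00 hk]] := factor_sign ckap kap0.
(* Inside [W] the factor stays away from 0, so that trapped solutions never stop winding. *)
pose W := V `&` [set p | k0 / 2 < (-1) ^+ b * kap p].
have oW : open W.
  apply: openI => //.
  apply: (@open_comp _ _ (fun p => (-1) ^+ b * kap p) [set x | k0 / 2 < x]).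
    by move=> p _; apply: (cont_mul (@cont_cst R _ _) ckap).
  exact: open_gt.
have sW : Gamma `<=` W.
  move=> p Gp; split; first exact: sV.
  by apply: lt_le_trans (hk p Gp); rewrite gtr_pMr// invf_lt1// ltr1n.
have [d1 d10 hd1] := meridian_tube_nbhs a1 oW sW.
(* The wedge must lie in [W] and, if [be > 0], be thin enough for [be * m] to dominate [al * l]. The
   [+ 1] in the denominator allows [al = 0]. *)
have [d [d0 dd1 hd]] : exists d, [/\ 0 < d, d <= d1 &
    0 < be -> `|al| * d <= be / 2].
  have [b0|b0] := ltP 0 be; last by exists d1; split.
  have q0 : 0 < be / 2 / (`|al| + 1).
    by rewrite !divr_gt0// ltr_wpDl.
  exists (Num.min d1 (be / 2 / (`|al| + 1))); split.
  - by rewrite lt_min d10.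
  - by rewrite ge_min lexx.
  - move=> _; apply: (@le_trans _ _ (`|al| * (be / 2 / (`|al| + 1)))).
      by rewrite ler_wpM2l// ge_min lexx orbT.
    rewrite mulrCA ler_piMr ?divr_ge0 ?(ltW b0)//.
    by rewrite ler_pdivrMr ?mul1r ?lerDl// ltr_wpDl.
pose U := [set p : 'rV[R]_3 | 0 < mc theta p] `&`
  [set p | 0 < d * mc theta p - `|lc theta p|].
have cd : continuous (fun p : 'rV[R]_3 => d * mc theta p - `|lc theta p|).
  cont.
  by move=> p; exact: continuous_comp (@lc_cont R theta p)
    (@norm_continuous _ _ (lc theta p)).
exists U; split.
- apply: openI.
    apply: (@open_comp _ _ (mc theta) [set x | 0 < x]); last exact: open_gt.
    by move=> p _; exact: mc_cont.
  apply: (@open_comp _ _ (fun p : 'rV[R]_3 => d * mc theta p - `|lc theta p|)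
    [set x | 0 < x]); last exact: open_gt.
  by move=> p _; exact: cd.
- move=> p /(meridianE a theta p)[_ l0 m0]; split => //=.
  by rewrite l0 normr0 subr0 mulr_gt0.
move=> c sol [/= m0]; rewrite subr_gt0 => /ltW l0 hside.
have tc := in_frame_torus sol.
have [|trap conv] := @reduced_attracted R a al be _ _ _ _ a1 sol d m0 l0.
  case: albe => [b0|[b0 al0]]; first by left; split=> //; exact: hd.
  by right; split => //; exact: hside.
have Wc t : 0 <= t -> W (c t).
  move=> t0; have [mt lt] := trap t t0; apply: hd1 => //.
  by apply: (le_trans lt); rewrite ler_pM2r.
split=> [t /Wc[]//|]; apply/seteqP; split=> p.
- move=> clp; apply/meridianE.
  have tp : torus a p.
    apply/(torusE a theta)/eqP; rewrite -subr_eq0 -normr_le0.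
    pose g (q : 'rV[R]_3) := `|(lc theta q ^+ 2 + mc theta q ^+ 2 - a ^+ 2) ^+ 2 +
      q 0 iz ^+ 2 - 1|.
    apply: (@cluster_le c g p 0) => //.
      have cg : continuous (fun q : 'rV[R]_3 => (lc theta q ^+ 2 +
          mc theta q ^+ 2 - a ^+ 2) ^+ 2 + q 0 iz ^+ 2 - 1).
        by cont.
      by move=> q; exact: continuous_comp (cg q) (@norm_continuous _ _ _).
    by move=> t _; rewrite /g (iffLR (torusE a theta (c t)) (tc t)) subrr normr0.
  (* Closed conditions that hold eventually pass to limit points; letting [e] tend to 0 gives
     [l = 0]. *)
  have le_e e : 0 < e -> `|lc theta p| - e * mc theta p <= 0.
    move=> e0; have [T hT] := conv e e0.
    apply: (@cluster_le c (fun q => `|lc theta q| - e * mc theta q) p T) => //.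
      cont.
      by move=> q; exact: continuous_comp (@lc_cont R theta q)
        (@norm_continuous _ _ (lc theta q)).
    by move=> t /hT; rewrite subr_le0.
  have m_ge0 : 0 <= mc theta p.
    have := le_e 1 ltr01; have := normr_ge0 (lc theta p); lra.
  have lp : lc theta p = 0.
    apply/eqP; rewrite -normr_le0 leNgt; apply/negP => lp.
    have M0 : 0 < mc theta p + 1 by rewrite ltr_wpDl.
    have := le_e (`|lc theta p| / (mc theta p + 1)) (divr_gt0 lp M0).
    rewrite subr_le0 -mulrA -{1}[`|lc theta p|]mulr1 ler_pM2l//.
    by rewrite ler_pdivlMl// mulr1; lra.
  (* On the axis the torus equation would read [a ^ 4 + z ^ 2 = 1], impossible for [a > 1]. *)
  split=> //; rewrite lt_neqAle m_ge0 andbT eq_sym; apply/eqP => mp.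
  have := (iffLR (torusE a theta p) tp); rewrite lp mp expr0n addr0 add0r => e.
  have a21 : 1 < a ^+ 2 by rewrite exprn_egt1.
  by have := sqr_ge0 (p 0 iz); nra.
(* Conversely, [p] has ratio 0 and some angle [psi]. The solution takes the angle [psi] at
   arbitrarily late times, when its ratio is close to 0, so it comes back near [p]. *)
- move=> Gp A B [T [_ hT]] hB.
  have [tp l0' m0'] := (meridianE a theta p).1 Gp.
  have [psi [_ hc hs]] := torus_angle theta tp.
  have pE : tube theta a (0, psi) = p.
    by rewrite -[RHS](tubeK m0' hc hs) l0' mul0r.
  have : nbhs (tube theta a (0, psi)) B by rewrite pE.
  move=> /(@tube_cont R a theta (0, psi)) [/= [X Y] [/= hX hY] XY].
  have [e /= e0 he] := hX.
  have [T2 hT2] := conv (e / 2) (divr_gt0 e0 (ltr0Sn _ 1)).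
  (* After [T3] the solution is trapped, lies in [A] (which requires [T < t] strictly, hence
     [T + 1]) and has a ratio at most [e / 2]. *)
  pose T3 := Num.max 0 (Num.max (T + 1) T2).
  have [|t T3t|t [T3t hct hst]] := @reduced_winding R a al be _ _ _ _
      (k0 / 2) b T3 psi a1 sol.
  + by rewrite divr_gt0.
  + by apply/ltW/(Wc t _).2; apply: le_trans T3t; rewrite le_max lexx.
  have t0 : 0 <= t by apply: le_trans T3t; rewrite le_max lexx.
  have Tt : T < t.
    apply: (@lt_le_trans _ _ (T + 1)); first by rewrite ltrDl.
    by apply: le_trans T3t; rewrite !le_max lexx !orbT.
  have T2t : T2 <= t by apply: le_trans T3t; rewrite !le_max lexx !orbT.
  have [mt _] := trap t t0.
  exists (c t); split; first exact: hT.
  rewrite -(@tubeK R a theta (c t) psi mt)//.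
  apply: XY; split => /=; last exact: nbhs_singleton.
  apply: he; rewrite /ball_ /= sub0r normrN normrM normfV (gtr0_norm mt).
  rewrite ltr_pdivrMr//; apply: (le_lt_trans (hT2 t T2t)); rewrite ltr_pM2r//.
  by rewrite gtr_pMr// invf_lt1// ltr1n.
Qed.

End Meridian.

Lemma ninfty_opp (R : realType) (T : Type) (c : R -> T) :
  c @ -oo = (fun t => c (- t)) @ +oo.
Proof.
apply/seteqP; split=> A [M [_ hM]]; exists (- M); split; rewrite ?num_real//.
- by move=> t Mt /=; apply: hM; rewrite ltrNl.
- by move=> t Mt; rewrite /= -[t]opprK; apply: hM; rewrite ltrNr.
Qed.

(** * Limit cycles and stability in the frame of a meridian *)

Section MeridianDynamics.
Variable R : realType.
Variables (a theta al be k0 k1 k2 k3 : R) (chi : 3.-tuple (mpoly.mpoly 3 R)).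
Hypothesis a1 : 1 < a.
Implicit Types (p : 'rV[R]_3) (c : R -> 'rV[R]_3).
Let Gamma := meridian a theta.
Let kap p := k0 + k1 * p 0 ix + k2 * p 0 iy + k3 * p 0 iz.
Hypothesis trajE : forall c, trajectory a chi c <-> in_frame a theta al be kap c.

Let ckap : continuous kap. Proof. by rewrite /kap; cont. Qed.

Let kapE p : kap p = k0 + (k2 * cos theta - k1 * sin theta) * lc theta p
  + (k1 * cos theta + k2 * sin theta) * mc theta p + k3 * p 0 iz.
Proof. rewrite /kap (coord_x theta p) (coord_y theta p); ring. Qed.

Lemma periodic_meridian_factor : periodic_orbit a chi Gamma ->
  forall p, Gamma p -> kap p <> 0.
Proof.
move=> [c [T [/trajE sol _ _ [t1 ct1] GE]]] p Gp kp; apply: ct1.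
have [_ l0 _] := (meridianE a theta p).1 Gp.
move: Gp; rewrite GE => -[t0 _ ct0].
have [||el em ez] := @reduced_equilibrium R a al be _ _ _ _ _ _ _ _ t0 sol
  (fun t => kapE (c t)) _ _ t1; rewrite ?ct0//.
by rewrite -(pt_coords theta (c t1)) -(pt_coords theta (c 0)) el em ez.
Qed.

Lemma periodic_meridian : (forall p, Gamma p -> kap p <> 0) ->
  periodic_orbit a chi Gamma.
Proof.
move=> kap0.
have tubeE psi : tube theta a (0, psi) =
    pt theta 0 (Num.sqrt (a ^+ 2 + cos psi)) (sin psi).
  by rewrite /tube /= mul0r expr0n addr0 divr1.
have [psi|phi [S S0 [sol sphi pphi]]] := @meridian_flow R a al be k0
    (k1 * cos theta + k2 * sin theta) k3 a1.
  have := kap0 _ (tube0_meridian theta a1 psi); rewrite kapE tubeE.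
  by rewrite lc_pt mc_pt ptz mulr0 addr0 => /eqP.
pose c t := tube theta a (0, phi t).
have lcc t : lc theta (c t) = 0 by rewrite /c tubeE lc_pt.
have mcc t : mc theta (c t) = Num.sqrt (a ^+ 2 + cos (phi t)).
  by rewrite /c tubeE mc_pt.
have zcc t : c t 0 iz = sin (phi t) by rewrite /c tubeE ptz.
exists c, S; split=> //.
- apply/trajE; rewrite /in_frame.
  rewrite (_ : (fun t => lc theta (c t)) = (fun=> 0)); last exact/funext.
  rewrite (_ : (fun t => mc theta (c t)) =
    (fun t => Num.sqrt (a ^+ 2 + cos (phi t)))); last exact/funext.
  rewrite (_ : (fun t => c t 0 iz) = (fun t => sin (phi t))); last exact/funext.
  congr reduced: sol; apply/funext => t.
  by rewrite kapE lcc mcc zcc mulr0 addr0.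
- by move=> t; rewrite /c !tubeE; have [-> ->] := pphi t.
- apply: contrapT => /forallNP h.
  have cst t : sin (phi t) = sin (phi 0).
    by rewrite -!zcc; have /contrapT -> := h t.
  have [t1 e1] := sphi 0; have [t2 e2] := sphi (pi / 2).
  have := cst t1; rewrite -(cst t2) e1 e2 sin0 sin_pihalf => /eqP.
  by rewrite eq_sym oner_eq0.
- apply/seteqP; split=> [p Gp|p [t _ <-]]; last exact: tube0_meridian.
  have [tp l0 m0] := (meridianE a theta p).1 Gp.
  have [psi [_ hc hs]] := torus_angle theta tp; have [t et] := sphi psi.
  by exists t => //; rewrite -(tubeK m0 hc hs) l0 mul0r /c et.
Qed.

Lemma meridian_limit_cycle : al != 0 \/ be != 0 ->
  (forall p, Gamma p -> kap p <> 0) -> limit_cycle a chi Gamma.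
Proof.
move=> albe kap0; split; first exact: periodic_meridian.
(* The extra factor [be] makes [h] equal to [be ^ 2 * m] on the meridian, positive for either sign
   of [be]. *)
pose h p := be * (al * lc theta p + be * mc theta p).
have ch : continuous h by rewrite /h; cont.
(* A periodic orbit has [l = 0] or [al * l + be * m = 0], otherwise its cosine
   [m / r] would be strictly monotone; the second case is excluded here. *)
exists ([set p : 'rV[R]_3 | 0 < mc theta p] `&` [set p | be = 0 \/ 0 < h p]); split.
- apply: openI.
    apply: (@open_comp _ _ (mc theta) [set x | 0 < x]); last exact: open_gt.
    by move=> p _; exact: mc_cont.
  have [b0|b0] := pselect (be = 0).
    rewrite (_ : [set p | _] = setT); first exact: openT.
    by apply/seteqP; split=> // p _; left.
  rewrite (_ : [set p | _] = h @^-1` [set x | 0 < x]).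
    by apply: open_comp; [move=> p _; exact: ch|exact: open_gt].
  by apply/seteqP; split=> p /=; [case|right].
- move=> p /(meridianE a theta p)[_ l0 m0]; split=> //=.
  have [->|b0] := eqVneq be 0; [by left|right].
  by rewrite /h l0 mulr0 add0r mulrA mulr_gt0// -expr2 exprn_even_gt0.
move=> Gamma' [c [T [/trajE sol T0 cT [_ _] ->]]] [_ [[t0 _ <-] [/= m0 h0]]].
have [E hE] := reduced_l_sign sol; have [H hH] := reduced_h_sign sol.
have cT0 : c T = c 0 by rewrite -(cT 0) add0r.
have l00 : lc theta (c 0) = 0.
  have [||//|h00] := reduced_periodic a1 sol T0; rewrite ?cT0//.
  have ht : al * lc theta (c t0) + be * mc theta (c t0) = 0.
    by rewrite (hH t0).2 h00 mul0r.
  case: h0 => [b0|]; last by rewrite /h ht mulr0 ltxx.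
  move/eqP: h00; rewrite b0 mul0r addr0 mulf_eq0.
  by case: albe => [/negbTE -> /eqP|]; rewrite ?b0 ?eqxx.
have lt t : lc theta (c t) = 0 by rewrite (hE t).2 l00 mul0r.
(* Once [l = 0], the equation of [m] is linear, so the orbit stays in the half plane of this
   meridian and not of the opposite one. *)
have [M hM] : exists M : R -> R, forall t,
    0 < M t /\ mc theta (c t) = mc theta (c 0) * M t.
  have [ck _ dm dz _] := sol.
  have cz : continuous (fun t => c t 0 iz) by move=> t; exact: der_continuous (dz t).
  apply: (@linear_ode_solution _ _ (fun t => kap (c t) * c t 0 iz / 4)).
    exact: cont_mul (cont_mul ck cz) (@cont_cst R _ _).
  by move=> t; apply: (is_derive_eq (dm t)); rewrite lt; ring.
have m00 : 0 < mc theta (c 0) by move: m0; rewrite (hM t0).2 pmulr_lgt0// (hM t0).1.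
have mt t : 0 < mc theta (c t) by rewrite (hM t).2 mulr_gt0// (hM t).1.
have Gc t : Gamma (c t).
  by apply/meridianE; split=> //; exact: (in_frame_torus sol).
apply/seteqP; split=> [_ [t _ <-]//|p Gp].
have [b [e e0 he]] := factor_sign a1 ckap kap0.
have [tp lp mp] := (meridianE a theta p).1 Gp.
have [psi [_ hc hs]] := torus_angle theta tp.
have [t _|t [_ hct hst]] := @reduced_winding R a al be _ _ _ _ e b 0 psi a1 sol e0.
  exact: he _ (Gc t).
exists t => //; rewrite -(tubeK mp hc hs) -(tubeK (mt t) hct hst).
by rewrite lt lp !mul0r.
Qed.

(** If [be = 0], then f is [al * l ^ 2], of the same sign on both sides: the angle approaches the
    meridian from one side and leaves it on the other, so [D] has to select a side. *)
Lemma meridian_stable (D : set 'rV[R]_3) : (forall p, Gamma p -> kap p <> 0) ->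
  0 < be \/ [/\ be = 0, al != 0 & forall p, D p -> 0 <= al * lc theta p] ->
  stable_within a chi D Gamma.
Proof.
move=> kap0 side V oV sV.
have [|U [oU sU hU]] := @attracting R a theta a1 al be kap V ckap kap0 _ oV sV.
  by case: side => [|[]]; [left|right].
exists U; split => // c /trajE sol [Uc Dc]; apply: hU => // b0.
by case: side => [|[_ _]]; [rewrite b0 ltxx|apply].
Qed.

Lemma meridian_unstable (D : set 'rV[R]_3) : (forall p, Gamma p -> kap p <> 0) ->
  be < 0 \/ [/\ be = 0, al != 0 & forall p, D p -> al * lc theta p <= 0] ->
  unstable_within a chi D Gamma.
Proof.
move=> kap0 side V oV sV.
have [|||U [oU sU hU]] := @attracting R a theta a1 (- al) (- be)
    (fun p => - kap p) V _ _ _ oV sV.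
- exact: cont_opp.
- by move=> p /kap0 h /eqP; rewrite oppr_eq0 => /eqP.
- case: side => [b0|[-> al0 _]]; first by left; rewrite oppr_gt0.
  by right; rewrite oppr0 oppr_eq0.
exists U; split => // c /trajE /reduced_reverse sol [Uc Dc].
have [||hV hcl] := hU (fun t => c (- t)) sol; rewrite ?oppr0//.
  move=> b0; rewrite mulNr oppr_ge0.
  by case: side => [|[_ _]]; [rewrite -oppr_gt0 b0 ltxx|apply].
split; last by rewrite /alpha_limit ninfty_opp hcl.
by move=> t t0; have := hV (- t); rewrite opprK oppr_ge0; exact.
Qed.

End MeridianDynamics.

(** * Invariant meridian planes *)

Section LowDegree.
Variable R : realType.
Implicit Types (g h q : mpoly 3 R) (p : 'rV[R]_3).
Local Notation x := (vx R).
Local Notation y := (vy R).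
Local Notation z := (vz R).

Lemma peval_vx p : peval x p = p 0 ix. Proof. exact: mevalXU. Qed.
Lemma peval_vy p : peval y p = p 0 iy. Proof. exact: mevalXU. Qed.
Lemma peval_vz p : peval z p = p 0 iz. Proof. exact: mevalXU. Qed.
Lemma pevalD g h p : peval (g + h) p = peval g p + peval h p.
Proof. exact: mevalD. Qed.
Lemma pevalB g h p : peval (g - h) p = peval g p - peval h p.
Proof. exact: mevalB. Qed.
Lemma pevalN g p : peval (- g) p = - peval g p.
Proof. exact: mevalN. Qed.
Lemma pevalM g h p : peval (g * h) p = peval g p * peval h p.
Proof. exact: mevalM. Qed.
Lemma pevalZ c g p : peval (c *: g) p = c * peval g p.
Proof. exact: mevalZ. Qed.
Lemma pevalC c p : peval (mpolyC 3 c) p = c.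
Proof. exact: mevalC. Qed.
Lemma peval1 p : peval 1 p = 1.
Proof. exact: meval1. Qed.
Lemma pevalX g n p : peval (g ^+ n) p = peval g p ^+ n.
Proof. by elim: n => [|n IH]; rewrite ?expr0 ?peval1// !exprS pevalM IH. Qed.
Definition pevalE := (pevalD, pevalB, pevalN, pevalM, pevalZ, pevalC, peval1,
  pevalX, peval_vx, peval_vy, peval_vz).

Lemma monomial3 (m : multinom 3) :
  mpolyX R m = x ^+ m ix * y ^+ m iy * z ^+ m iz.
Proof.
rewrite mpolyXE_id !big_ord_recl big_ord0 mulr1 mulrA.
by congr (_ * _ * _); congr (mpolyX R (mnm1 _) ^+ m _); apply: val_inj.
Qed.

Lemma mdeg3 (m : multinom 3) : mdeg m = (m ix + m iy + m iz)%N.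
Proof.
rewrite mdegE !big_ord_recl big_ord0 addn0 addnA.
by congr (_ + _ + _)%N; congr (m _); apply: val_inj.
Qed.

Definition quadric (c0 c1 c2 c3 c4 c5 c6 c7 c8 c9 : R) : mpoly 3 R :=
  c0 *: 1 + c1 *: x + c2 *: y + c3 *: z + c4 *: (x * x) + c5 *: (x * y)
  + c6 *: (y * y) + c7 *: (x * z) + c8 *: (y * z) + c9 *: (z * z).

Lemma low_degree_ind (P : mpoly 3 R -> Prop) (d : nat) :
  P 0 -> (forall g h, P g -> P h -> P (g + h)) -> (forall c g, P g -> P (c *: g)) ->
  (forall i j k, (i + j + k <= d)%N -> P (x ^+ i * y ^+ j * z ^+ k)) ->
  forall g, (pdegree g <= d)%N -> P g.
Proof.
move=> P0 PD PZ PX g dg; rewrite [g]mpolyE big_seq.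
elim/big_ind: _ => // m mg; apply: PZ; rewrite monomial3; apply: PX.
by rewrite -mdeg3 -ltnS (leq_trans (msize_mdeg_lt mg))// (leq_trans (leqSpred _)).
Qed.

Lemma degree2_quadric g : (pdegree g <= 2)%N ->
  exists c0 c1 c2 c3 c4 c5 c6 c7 c8 c9, g = quadric c0 c1 c2 c3 c4 c5 c6 c7 c8 c9.
Proof.
move: g; apply: low_degree_ind.
- by exists 0, 0, 0, 0, 0, 0, 0, 0, 0, 0; rewrite /quadric !scale0r !addr0.
- move=> g h [a0 [a1 [a2 [a3 [a4 [a5 [a6 [a7 [a8 [a9 ->]]]]]]]]]]
    [b0 [b1 [b2 [b3 [b4 [b5 [b6 [b7 [b8 [b9 ->]]]]]]]]]].
  exists (a0 + b0), (a1 + b1), (a2 + b2), (a3 + b3), (a4 + b4), (a5 + b5),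
    (a6 + b6), (a7 + b7), (a8 + b8), (a9 + b9).
  by rewrite /quadric !scalerDl; ring.
- move=> c g [a0 [a1 [a2 [a3 [a4 [a5 [a6 [a7 [a8 [a9 ->]]]]]]]]]].
  exists (c * a0), (c * a1), (c * a2), (c * a3), (c * a4), (c * a5),
    (c * a6), (c * a7), (c * a8), (c * a9).
  by rewrite /quadric !scalerDr !scalerA.
- have E c0 c1 c2 c3 c4 c5 c6 c7 c8 c9 g : g = quadric c0 c1 c2 c3 c4 c5 c6 c7 c8 c9 ->
      exists c0 c1 c2 c3 c4 c5 c6 c7 c8 c9, g = quadric c0 c1 c2 c3 c4 c5 c6 c7 c8 c9.
    by move=> ->; do 10 eexists.
  have simp := (expr0, expr1, mul1r, mulr1, scale0r, scale1r, addr0, add0r).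
  case=> [|[|[|//]]]; case=> [|[|[|//]]]; case=> [|[|[|//]]] // _.
  + by apply: (E 1 0 0 0 0 0 0 0 0 0); rewrite /quadric !simp.
  + by apply: (E 0 0 0 1 0 0 0 0 0 0); rewrite /quadric !simp.
  + by apply: (E 0 0 0 0 0 0 0 0 0 1); rewrite /quadric !simp expr2.
  + by apply: (E 0 0 1 0 0 0 0 0 0 0); rewrite /quadric !simp.
  + by apply: (E 0 0 0 0 0 0 0 0 1 0); rewrite /quadric !simp.
  + by apply: (E 0 0 0 0 0 0 1 0 0 0); rewrite /quadric !simp expr2.
  + by apply: (E 0 1 0 0 0 0 0 0 0 0); rewrite /quadric !simp.
  + by apply: (E 0 0 0 0 0 0 0 1 0 0); rewrite /quadric !simp.
  + by apply: (E 0 0 0 0 0 1 0 0 0 0); rewrite /quadric !simp.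
  + by apply: (E 0 0 0 0 1 0 0 0 0 0); rewrite /quadric !simp expr2.
Qed.

Lemma degree1_affine g : (pdegree g <= 1)%N -> exists c0 c1 c2 c3, forall p,
  peval g p = c0 + c1 * p 0 ix + c2 * p 0 iy + c3 * p 0 iz.
Proof.
move: g; apply: low_degree_ind.
- by exists 0, 0, 0, 0 => p; rewrite /peval meval0; ring.
- move=> g h [a0 [a1 [a2 [a3 hg]]]] [b0 [b1 [b2 [b3 hh]]]].
  exists (a0 + b0), (a1 + b1), (a2 + b2), (a3 + b3) => p.
  by rewrite pevalD hg hh; ring.
- move=> c g [a0 [a1 [a2 [a3 hg]]]].
  by exists (c * a0), (c * a1), (c * a2), (c * a3) => p; rewrite pevalZ hg; ring.
- case=> [|[|//]]; case=> [|[|//]]; case=> [|[|//]] // _.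
  + by exists 1, 0, 0, 0 => p; rewrite !pevalE; ring.
  + by exists 0, 0, 0, 1 => p; rewrite !pevalE; ring.
  + by exists 0, 0, 1, 0 => p; rewrite !pevalE; ring.
  + by exists 0, 1, 0, 0 => p; rewrite !pevalE; ring.
Qed.

Lemma pdegree_mul_vz g (d : nat) : (pdegree (g * z)%R <= d.+1)%N -> (pdegree g <= d)%N.
Proof.
have [->|g0] := eqVneq g 0; first by rewrite /pdegree msize0.
have z0 : z != 0.
  by apply/eqP => /(congr1 (fun g => msize g)); rewrite msizeX msize0.
by rewrite /pdegree msizeM// msizeX mdeg1 addn2 /=; case: (msize g).
Qed.

(** Serves to cancel a factor [l] in a polynomial identity and still evaluate the quotient at
    [l = 0]. *)
Lemma peval_line_cont g theta m w :
  continuous (fun l : R => peval g (pt theta l m w)).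
Proof.
pose v (l : R) := pt theta l m w.
have cid : continuous (fun l : R => l) by move=> ?; exact: cvg_id.
elim/mpolyind: g => [|c mm g _ _ IH].
  have -> : (fun l => peval 0 (v l)) = (fun=> 0).
    by apply/funext => l; exact: meval0.
  by cont.
have -> : (fun l => peval (c *: mpolyX R mm + g) (v l)) =
    (fun l => c * ((m * cos theta - l * sin theta) ^+ mm ix *
      (m * sin theta + l * cos theta) ^+ mm iy * w ^+ mm iz) + peval g (v l)).
  by apply/funext => l; rewrite pevalD pevalZ monomial3 !pevalE ptx pty ptz.
by cont.
Qed.

End LowDegree.

(** * What invariance and multiplicity impose on f, beta and gamma *)

Section InvariantPlanes.
Variable R : realType.
Implicit Types (g h q : mpoly 3 R) (p : 'rV[R]_3) (theta : R).
Local Notation x := (vx R).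
Local Notation y := (vy R).
Local Notation z := (vz R).

Lemma peval_angle_form theta p : peval (angle_form theta) p = lc theta p.
Proof. by rewrite /angle_form /plane_form !pevalE. Qed.

Lemma angle_formDpi theta : angle_form (theta + pi) = - angle_form theta :> mpoly 3 R.
Proof.
by rewrite /angle_form /plane_form sinDpi cosDpi !scaleNr !opprD !opprK.
Qed.

Lemma pdvdN_exp h g k : pdvd ((- h) ^+ k) g <-> pdvd (h ^+ k) g.
Proof.
have aux h' : pdvd (h' ^+ k) g -> pdvd ((- h') ^+ k) g.
  case=> q ->; exists ((-1) ^+ k * q).
  by rewrite (exprNn h') mulrACA -expr2 sqrr_sign mul1r.
by split=> [/aux|/aux //]; rewrite opprK.
Qed.

Lemma plane_multiplicityDpi chi theta k :
  plane_multiplicity chi (- sin (theta + pi)) (cos (theta + pi)) k <->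
  plane_multiplicity chi (- sin theta) (cos theta) k.
Proof.
rewrite /plane_multiplicity -/(angle_form (theta + pi)) -/(angle_form theta).
rewrite angle_formDpi.
split=> -[h1 h2 h3 h4]; split=> //; try exact: (pdvdN_exp _ _ _).1 h3;
  try exact: (pdvdN_exp _ _ _).2 h3.
  by move=> j hj; apply: h4; exact: (pdvdN_exp _ _ _).2 hj.
by move=> j hj; apply: h4; exact: (pdvdN_exp _ _ _).1 hj.
Qed.

Lemma plane_multiplicity_uniq chi (lambda mu : R) j k :
  plane_multiplicity chi lambda mu j -> plane_multiplicity chi lambda mu k -> j = k.
Proof.
move=> [_ _ h1 h2] [_ _ h3 h4]; apply/eqP.
by rewrite eqn_leq (h4 _ h1) (h2 _ h3).
Qed.

Lemma invariant_meridianDpi chi theta :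
  invariant_meridian chi (theta + pi) <-> invariant_meridian chi theta.
Proof.
rewrite /invariant_meridian /invariant_surface angle_formDpi.
have fN g : apply_field chi (- g) = - apply_field chi g.
  rewrite /apply_field -sumrN; apply: eq_bigr => i _.
  by rewrite mderivN mulrN.
split=> -[L h]; exists L; move: h; rewrite fN mulrN.
  by move/oppr_inj.
by move=> ->.
Qed.

Lemma peval_apply_angle_form chi theta p :
  peval (apply_field chi (angle_form theta)) p =
  - sin theta * peval (tnth chi ix) p + cos theta * peval (tnth chi iy) p.
Proof.
have X i j : mderiv j (mpolyX R (mnm1 i)) = (i == j)%:R *: (1 : mpoly 3 R).
  rewrite mderivX mnm1E; have [->|_] := eqVneq i j; last by rewrite !scale0r.
  by congr (_ *: _); rewrite -mpolyX0; congr (mpolyX R _); apply/mnmP => k;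
    rewrite mnmBE subnn mnm0E.
rewrite /apply_field !big_ord_recl big_ord0 !pevalE.
have -> : lift ord0 (ord0 : 'I_2) = iy by apply: val_inj.
have -> : lift ord0 (lift ord0 (ord0 : 'I_1)) = iz by apply: val_inj.
rewrite -/ix /angle_form /plane_form !mderivD !mderivZ /vx /vy !X !pevalE.
by rewrite /=; ring.
Qed.

Variables (f K K' : mpoly 3 R) (beta gamma : R) (chi : 3.-tuple (mpoly 3 R)).
Hypothesis hP : tnth chi ix = 4^-1 *: (K * x) + f * y + beta *: z.
Hypothesis hQ : tnth chi iy = 4^-1 *: (K * y) - f * x + gamma *: z.

(** Evaluation on the plane removes the cofactor, and also the K-part of the field, which is
    radial. *)
Lemma invariant_meridian_plane theta : invariant_meridian chi theta ->
  forall p, lc theta p = 0 ->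
  (gamma * cos theta - beta * sin theta) * p 0 iz = peval f p * mc theta p.
Proof.
move=> [L /(congr1 (fun g => peval g _)) h] p lp.
have := h p; rewrite peval_apply_angle_form pevalM peval_angle_form lp mulr0 hP hQ.
rewrite !pevalE => e.
have : 4^-1 * peval K p * lc theta p = 0 by rewrite lp mulr0.
by rewrite /lc /mc; lra.
Qed.

Lemma peval_extactic theta p : peval (extactic chi) p =
  - peval f p * (lc theta p ^+ 2 + mc theta p ^+ 2)
  + (gamma * p 0 ix - beta * p 0 iy) * p 0 iz.
Proof. by rewrite /extactic hP hQ sqr_coords !pevalE; ring. Qed.

Hypothesis hf : (pdegree f <= 2)%N.

Lemma invariant_meridian_factor theta : invariant_meridian chi theta ->
  gamma * cos theta = beta * sin theta /\
  exists A B C D, forall p, peval f p =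
    lc theta p * (A * lc theta p + B * mc theta p + C * p 0 iz + D).
Proof.
move=> /invariant_meridian_plane h.
have e0 : gamma * cos theta - beta * sin theta = 0.
  (* A point of the z-axis, where the term in f drops out. *)
  have := h (pt theta 0 0 1); rewrite lc_pt mc_pt ptz => /(_ erefl); lra.
split; first by lra.
have [c0 [c1 [c2 [c3 [c4 [c5 [c6 [c7 [c8 [c9 fE]]]]]]]]]] := degree2_quadric hf.
pose cs := cos theta; pose sn := sin theta.
(* Coefficients of f in the coordinates [l], [m], [z]. Those of the part without [l] are [E], [F],
   [c9], [H], [c3], [c0]; the six evaluations below show that they vanish. *)
pose A := c4 * sn ^+ 2 - c5 * sn * cs + c6 * cs ^+ 2.
pose B := c5 * (cs ^+ 2 - sn ^+ 2) + 2 * (c6 - c4) * sn * cs.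
pose C := c8 * cs - c7 * sn.
pose D := c2 * cs - c1 * sn.
pose E := c4 * cs ^+ 2 + c5 * cs * sn + c6 * sn ^+ 2.
pose F := c7 * cs + c8 * sn.
pose H := c1 * cs + c2 * sn.
have fp p : peval f p =
    lc theta p * (A * lc theta p + B * mc theta p + C * p 0 iz + D)
    + (E * mc theta p ^+ 2 + F * mc theta p * p 0 iz + c9 * p 0 iz ^+ 2
       + H * mc theta p + c3 * p 0 iz + c0).
  rewrite fE /quadric !pevalE (coord_x theta p) (coord_y theta p).
  by rewrite /A /B /C /D /E /F /H /cs /sn; ring.
have v m w : m != 0 ->
    E * m ^+ 2 + F * m * w + c9 * w ^+ 2 + H * m + c3 * w + c0 = 0.
  move=> m0; have := h (pt theta 0 m w); rewrite lc_pt mc_pt ptz => /(_ erefl).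
  rewrite fp lc_pt mc_pt ptz e0 !mul0r add0r => /esym/eqP.
  by rewrite mulf_eq0 (negbTE m0) orbF => /eqP.
have n1 : (-1 : R) != 0 by rewrite oppr_eq0 oner_eq0.
have n2 : (2 : R) != 0 by rewrite pnatr_eq0.
have v1 := v 1 0 (oner_neq0 _); have v2 := v (-1) 0 n1; have v3 := v 2 0 n2.
have v4 := v 1 1 (oner_neq0 _); have v5 := v 1 (-1) (oner_neq0 _).
have v6 := v 2 1 n2.
have E0 : E = 0 by lra.
have F0 : F = 0 by lra.
have c90 : c9 = 0 by lra.
have H0 : H = 0 by lra.
have c30 : c3 = 0 by lra.
have c00 : c0 = 0 by lra.
by exists A, B, C, D => p; rewrite fp E0 F0 c90 H0 c30 c00; ring.
Qed.

Lemma lc_frame theta theta' p : lc theta' p =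
  cos (theta - theta') * lc theta p + sin (theta - theta') * mc theta p.
Proof.
rewrite {1}/lc (coord_x theta p) (coord_y theta p) cosB sinB; ring.
Qed.

(** The two linear relations between beta and gamma have determinant [sin (theta - theta')] up to
    sign. The cofactor of the first form in f then vanishes on the second plane, hence is a multiple
    of the second form. *)
Lemma two_invariant_meridians theta theta' : invariant_meridian chi theta ->
  invariant_meridian chi theta' -> sin (theta - theta') != 0 ->
  [/\ beta = 0, gamma = 0 & exists c, forall p,
    peval f p = c * lc theta p * lc theta' p].
Proof.
move=> /invariant_meridian_factor[e [A [B [C [D fE]]]]] inv' s0.
have [e' _] := invariant_meridian_factor inv'.
have h := invariant_meridian_plane inv'.
have beta0 : beta = 0.
  apply: (mulIf s0); rewrite mul0r sinB.
  have : (gamma * cos theta) * cos theta' = (gamma * cos theta') * cos theta by ring.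
  by rewrite e e'; lra.
have gamma0 : gamma = 0.
  apply: (mulIf s0); rewrite mul0r sinB.
  have : (gamma * cos theta) * sin theta' = (gamma * cos theta') * sin theta.
    by rewrite e e'; ring.
  lra.
split => //.
set sg := sin (theta - theta') in s0.
pose ka := cos (theta - theta').
have v m w : m != 0 -> - A * sg * m + B * ka * m + C * w + D = 0.
  move=> m0; have := h (pt theta' 0 m w).
  rewrite lc_pt mc_pt ptz => /(_ erefl).
  have el : lc theta (pt theta' 0 m w) = - sg * m.
    by rewrite (lc_frame theta' theta) lc_pt mc_pt mulr0 add0r -opprB sinN.
  have em : mc theta (pt theta' 0 m w) = ka * m.
    by rewrite /mc ptx pty /ka cosB; ring.
  rewrite fE el em ptz beta0 gamma0 !mul0r subrr mul0r => /esym/eqP.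
  rewrite !mulf_eq0 oppr_eq0 (negbTE s0) (negbTE m0) /= orbF => /eqP <-; ring.
have n1 : (-1 : R) != 0 by rewrite oppr_eq0 oner_eq0.
have v1 := v 1 0 (oner_neq0 _); have v2 := v (-1) 0 n1.
have v3 := v 1 1 (oner_neq0 _).
have D0 : D = 0 by lra.
have C0 : C = 0 by lra.
have AB : A * sg = B * ka by lra.
exists (B / sg) => p; rewrite fE C0 D0 (lc_frame theta theta') -/sg -/ka.
have -> : A = B * ka / sg by rewrite -AB mulfK.
by field.
Qed.

Lemma double_invariant_meridian theta : invariant_meridian chi theta ->
  pdvd (angle_form theta ^+ 2) (extactic chi) ->
  [/\ beta = 0, gamma = 0 & exists c, forall p,
    peval f p = c * lc theta p * lc theta p].
Proof.
move=> /invariant_meridian_factor[e [A [B [C [D fE]]]]] [q hq].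
pose ka := gamma * sin theta + beta * cos theta.
have v m w : (B * m + C * w + D) * m ^+ 2 + ka * w = 0.
  (* The extactic polynomial is [- l * br], so divisibility by [l ^ 2] gives [br + q * l = 0] off
     the plane, and [br 0 = 0] by continuity. *)
  pose br (l : R) := (A * l + B * m + C * w + D) * (l ^+ 2 + m ^+ 2) + ka * w.
  have hl l : br l + peval q (pt theta l m w) * l = 0 \/ l = 0.
    have [->|l0] := eqVneq l 0; [by right|left].
    apply: (mulIf l0); rewrite mul0r.
    have := congr1 (fun g => peval g (pt theta l m w)) hq.
    rewrite (peval_extactic theta) pevalM pevalX peval_angle_form fE lc_pt mc_pt.
    rewrite ptx pty ptz /br /ka => h.
    have e2 : (gamma * cos theta) * m = beta * sin theta * m by rewrite e.
    have e3 : (gamma * cos theta) * m * w = beta * sin theta * m * w by rewrite e.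
    by lra.
  have cbr : continuous (fun l : R => br l + peval q (pt theta l m w) * l).
    rewrite /br; cont; try exact: peval_line_cont; by move=> ?; exact: cvg_id.
  pose G l := br l + peval q (pt theta l m w) * l.
  suff : G 0 = 0 by move=> <-; rewrite /G /br; ring.
  apply/eqP/negPn/negP => G0.
  have : \forall l \near (0 : R), G l != 0.
    exact: (cvgr_neq0 (G 0) (cbr 0)).
  case=> d /= d0 hd.
  have : G (d / 2) != 0.
    apply: hd; rewrite /ball_ /= sub0r normrN gtr0_norm ?divr_gt0//.
    by rewrite gtr_pMr// invf_lt1// ltr1n.
  have [h0|d20] := hl (d / 2); first by rewrite /G h0 eqxx.
  by move/eqP: d20; rewrite mulf_eq0 invr_eq0 pnatr_eq0 orbF gt_eqF.
have v0 := v 0 1; have v1 := v 1 0; have v2 := v (-1) 0; have v3 := v 1 1.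
have ka0 : ka = 0 by lra.
have D0 : D = 0 by lra.
have B0 : B = 0 by lra.
have C0 : C = 0 by lra.
have h1 := cos2Dsin2 theta.
split.
- rewrite -[LHS]mul1r -h1.
  have : ka * cos theta - (gamma * cos theta - beta * sin theta) * sin theta = 0.
    by rewrite e subrr ka0; ring.
  by rewrite /ka; lra.
- rewrite -[LHS]mul1r -h1.
  have : ka * sin theta + (gamma * cos theta - beta * sin theta) * cos theta = 0.
    by rewrite e subrr ka0; ring.
  by rewrite /ka; lra.
- by exists A => p; rewrite fE B0 C0 D0; ring.
Qed.

(** Here the extactic polynomial is [- f * (x ^ 2 + y ^ 2)], and ten evaluations determine the ten
    coefficients of f. This will give [c != 0]. *)
Lemma extactic_neq0 : beta = 0 -> gamma = 0 -> extactic chi <> 0 ->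
  exists p, peval f p <> 0.
Proof.
move=> b0 g0 ext0; apply: contrapT => /forallNP h; apply: ext0.
have {}h p : peval f p = 0 by apply: contrapT.
have [c0 [c1 [c2 [c3 [c4 [c5 [c6 [c7 [c8 [c9 fE]]]]]]]]]] := degree2_quadric hf.
have v u v w : c0 + c1 * u + c2 * v + c3 * w + c4 * (u * u) + c5 * (u * v)
    + c6 * (v * v) + c7 * (u * w) + c8 * (v * w) + c9 * (w * w) = 0.
  have := h (\row_i nth 0 [:: u; v; w] i).
  by rewrite fE /quadric !pevalE !mxE /= mulr1.
have v0 := v 0 0 0.
have v1 := v 1 0 0; have v2 := v (-1) 0 0; have v3 := v 0 1 0.
have v4 := v 0 (-1) 0; have v5 := v 0 0 1; have v6 := v 0 0 (-1).
have v7 := v 1 1 0; have v8 := v 1 0 1; have v9 := v 0 1 1.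
have -> : extactic chi = - f * (x * x + y * y).
  rewrite /extactic hP hQ b0 g0 !scale0r !addr0 mulrDr mulrDr -!scalerAr.
  by rewrite (mulrCA x K) (mulrCA y K) (mulrC y x); ring.
have -> : f = 0; last by rewrite oppr0 mul0r.
rewrite fE /quadric.
have -> : c0 = 0 by lra.
have -> : c1 = 0 by lra.
have -> : c2 = 0 by lra.
have -> : c3 = 0 by lra.
have -> : c4 = 0 by lra.
have -> : c5 = 0 by lra.
have -> : c6 = 0 by lra.
have -> : c7 = 0 by lra.
have -> : c8 = 0 by lra.
have -> : c9 = 0 by lra.
by rewrite !scale0r !addr0.
Qed.

End InvariantPlanes.

(** * The four meridians *)

Lemma is_derive_rowP (R : realType) n (c : R -> 'rV[R]_n) (t : R) v :
  is_derive t 1 c v <-> forall i, is_derive t 1 (fun s => c s 0 i) (v 0 i).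
Proof.
split=> [[dc <-] i|h].
  apply: DeriveDef; first exact: ((derivable_mxP _ _ _).1 dc).
  by rewrite derive_mx// mxE.
have dc : derivable c t 1.
  by apply/derivable_mxP => i j; rewrite (ord1 i); case: (h j).
apply: DeriveDef => //; rewrite derive_mx//; apply/rowP => j; rewrite mxE.
by case: (h j).
Qed.

Section Assembly.
Variable R : realType.
Implicit Types (p : 'rV[R]_3) (theta : R) (ts : seq R).

Lemma sorted_closed_four ts : sorted <=%R ts -> size ts = 4%N ->
  (forall t, t \in ts -> 0 <= t < 2 * pi) ->
  (forall t, t \in ts -> t < pi -> t + pi \in ts) ->
  (forall t, t \in ts -> pi <= t -> t - pi \in ts) ->
  (forall t, t \in ts -> t + pi \in ts -> count_mem (t + pi) ts = count_mem t ts) ->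
  exists t1 t2, [/\ ts = [:: t1; t2; t1 + pi; t2 + pi], t1 <= t2 & t2 < t1 + pi].
Proof.
case: ts => [|t0 [|t1 [|t2 [|t3 []]]]] //=; rewrite andbT.
move=> /and3P[h01 h12 h23] _ hr hp hm hc.
have p0 := @pi_gt0 R.
have m0 : t0 \in [:: t0; t1; t2; t3] by rewrite !inE eqxx.
have m1 : t1 \in [:: t0; t1; t2; t3] by rewrite !inE eqxx !orbT.
have m2 : t2 \in [:: t0; t1; t2; t3] by rewrite !inE eqxx !orbT.
have m3 : t3 \in [:: t0; t1; t2; t3] by rewrite !inE eqxx !orbT.
have [r0 r1 r2 r3] := And4 (hr _ m0) (hr _ m1) (hr _ m2) (hr _ m3).
have inP t : t \in [:: t0; t1; t2; t3] -> [\/ t = t0, t = t1, t = t2 | t = t3].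
  by rewrite !inE => /or4P[] /eqP ->;
    [constructor 1|constructor 2|constructor 3|constructor 4].
have t0pi : t0 < pi.
  by rewrite ltNge; apply/negP => h; case: (inP _ (hm _ m0 h)) => e; lra.
have i0 := hp _ m0 t0pi; have c0 := hc _ m0 i0.
have n0 : (t0 == t0 + pi) = false by apply/eqP; lra.
move: c0; rewrite n0 eqxx add0n; have [e1|ne1] := eqVneq t1 t0.
  have n1 : (t1 == t0 + pi) = false by apply/eqP; lra.
  move=> c0; exists t0, t1; move: c0; rewrite n1 /=.
  (* [t0] occurs at least twice, so [t0 + pi] does too and fills both remaining places. *)
  have [e2|_] := eqVneq t2 (t0 + pi); have [e3|_] := eqVneq t3 (t0 + pi).
  - by move=> _; rewrite e1 e2 e3; split=> //; lra.
  - by case: (t2 == t0); case: (t3 == t0).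
  - by case: (t2 == t0); case: (t3 == t0).
  - by case: (t2 == t0); case: (t3 == t0).
have lt01 : t0 < t1 by rewrite lt_neqAle eq_sym ne1.
have n2 : (t2 == t0) = false by apply/eqP; lra.
have n3 : (t3 == t0) = false by apply/eqP; lra.
rewrite n2 n3 !addn0 => c0.
(* Otherwise [t1] and [t2] would both be [t0 + pi], whereas [t0] occurs once. *)
have t1pi : t1 < pi.
  rewrite ltNge; apply/negP => h1.
  have h2 : pi <= t2 by exact: le_trans h12.
  have e1 : t1 = t0 + pi by case: (inP _ (hm _ m1 h1)) => e; lra.
  have e2 : t2 = t0 + pi by case: (inP _ (hm _ m2 h2)) => e; lra.
  by move: c0; rewrite e1 e2 eqxx.
have i1 := hp _ m1 t1pi.
exists t0, t1; have : t2 = t0 + pi /\ t3 = t1 + pi.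
  by case: (inP _ i0) => ei0; case: (inP _ i1) => ei1; lra.
by case=> -> ->; split => //; lra.
Qed.

Variables (a : R) (f K K' P Q S : mpoly 3 R) (beta gamma : R).
Hypothesis a1 : 1 < a.
Hypothesis hK : K = K' * vz R.
Hypothesis hdegf : (pdegree f <= 2)%N.
Hypothesis hdegK : (pdegree K <= 2)%N.
Hypothesis hP : P = 4^-1 *: (K * vx R) + f * vy R + beta *: vz R.
Hypothesis hQ : Q = 4^-1 *: (K * vy R) - f * vx R + gamma *: vz R.
Hypothesis hS : S = 2^-1 *: (K' * (- (a ^+ 2 *: (vx R ^+ 2 + vy R ^+ 2)) + vz R ^+ 2
                           + mpolyC 3 (a ^+ 4) - 1))
            - 2 *: ((beta *: vx R + gamma *: vy R)
                    * (vx R ^+ 2 + vy R ^+ 2 - mpolyC 3 (a ^+ 2))).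
Let chi := [tuple P; Q; S].
Let chiP : tnth chi ix = 4^-1 *: (K * vx R) + f * vy R + beta *: vz R.
Proof. exact: hP. Qed.
Let chiQ : tnth chi iy = 4^-1 *: (K * vy R) - f * vx R + gamma *: vz R.
Proof. exact: hQ. Qed.

Lemma lcDpi theta p : lc (theta + pi) p = - lc theta p.
Proof. by rewrite /lc sinDpi cosDpi; ring. Qed.

Lemma four_meridians ts : lists_invariant_meridians chi ts -> size ts = 4%N ->
  exists t1 t2 c, [/\ ts = [:: t1; t2; t1 + pi; t2 + pi],
    t1 <= t2 /\ t2 < t1 + pi, c != 0, beta = 0 /\ gamma = 0
    & forall p, peval f p = c * lc t1 p * lc t2 p].
Proof.
move=> [srt hin hmul] sz; have p0 := @pi_gt0 R.
have [t /hin[]//|t /hin[/andP[t0 _] inv] tpi|t /hin[/andP[_ t2] inv] tpi|t tin tpin|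
    t1 [t2 [tsE t12 t21]]] := @sorted_closed_four ts srt sz.
- by apply/hin; split; [lra|exact: (invariant_meridianDpi chi t).2 inv].
- apply/hin; split; first by lra.
  by apply: (invariant_meridianDpi chi (t - pi)).1; rewrite subrK.
- apply: plane_multiplicity_uniq (hmul _ tpin) _.
  by apply/plane_multiplicityDpi; exact: hmul.
have in1 : t1 \in ts by rewrite tsE !inE eqxx.
have in2 : t2 \in ts by rewrite tsE !inE eqxx orbT.
have [_ inv1] := (hin _).1 in1; have [_ inv2] := (hin _).1 in2.
have [ext0 _ hdvd _] := hmul _ in1.
have [b0 g0 [c fE]] : [/\ beta = 0, gamma = 0 & exists c, forall p,
    peval f p = c * lc t1 p * lc t2 p].
  have [lt12|le21] := ltP t1 t2.
    apply: (two_invariant_meridians chiP chiQ hdegf inv1 inv2).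
    by rewrite -opprB sinN oppr_eq0 gt_eqF// sin_gt0_pi//; lra.
  have e12 : t2 = t1 by lra.
  rewrite e12; apply: (double_invariant_meridian chiP chiQ hdegf inv1).
  move: hdvd; rewrite tsE e12 /= eqxx.
  by have -> : (t1 + pi == t1) = false by apply/eqP; lra.
exists t1, t2, c; split=> //; apply/eqP => c0.
have [p] := extactic_neq0 chiP chiQ hdegf b0 g0 ext0.
by rewrite fE c0 !mul0r.
Qed.

Hypotheses (beta0 : beta = 0) (gamma0 : gamma = 0).
Variables (k0 k1 k2 k3 : R).
Hypothesis K'E : forall p,
  peval K' p = k0 + k1 * p 0 ix + k2 * p 0 iy + k3 * p 0 iz.
Let kap p := k0 + k1 * p 0 ix + k2 * p 0 iy + k3 * p 0 iz.

Lemma field_x p : peval (tnth chi ix) p =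
  kap p * p 0 iz / 4 * p 0 ix + peval f p * p 0 iy.
Proof. by rewrite chiP beta0 hK scale0r addr0 !pevalE K'E -/(kap p); field. Qed.

Lemma field_y p : peval (tnth chi iy) p =
  kap p * p 0 iz / 4 * p 0 iy - peval f p * p 0 ix.
Proof. by rewrite chiQ gamma0 hK scale0r addr0 !pevalE K'E -/(kap p); field. Qed.

(** Eliminating [z ^ 2] by the torus equation is what factors the third component. *)
Lemma field_z p : torus a p -> peval (tnth chi iz) p =
  - kap p / 2 * (p 0 ix ^+ 2 + p 0 iy ^+ 2 - a ^+ 2)
    * (p 0 ix ^+ 2 + p 0 iy ^+ 2).
Proof.
move/(torusE a 0); rewrite sqr_coords => h.
rewrite (_ : tnth chi iz = S) // hS beta0 gamma0 !scale0r addr0 mul0r scaler0 subr0.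
rewrite !pevalE K'E -/(kap p).
have -> : p 0 iz ^+ 2 = 1 - (p 0 ix ^+ 2 + p 0 iy ^+ 2 - a ^+ 2) ^+ 2.
  by rewrite -h; ring.
by field.
Qed.

Section Frame.
Variables (theta al be : R).
Hypothesis fE : forall p,
  peval f p = lc theta p * (al * lc theta p + be * mc theta p).

Lemma trajectory_in_frame c :
  trajectory a chi c <-> in_frame a theta al be kap c.
Proof.
split=> [[tc dc]|sol].
  have {}dc t i := (is_derive_rowP c t _).1 (dc t) i.
  have dx (t : R) : is_derive t 1 (fun s => c s 0 ix) (peval (tnth chi ix) (c t)).
    by have := dc t ix; rewrite mxE.
  have dy (t : R) : is_derive t 1 (fun s => c s 0 iy) (peval (tnth chi iy) (c t)).
    by have := dc t iy; rewrite mxE.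
  have dz (t : R) : is_derive t 1 (fun s => c s 0 iz) (peval (tnth chi iz) (c t)).
    by have := dc t iz; rewrite mxE.
  have cx : continuous (fun s => c s 0 ix) by move=> t; exact: der_continuous (dx t).
  have cy : continuous (fun s => c s 0 iy) by move=> t; exact: der_continuous (dy t).
  have cz : continuous (fun s => c s 0 iz) by move=> t; exact: der_continuous (dz t).
  split=> [|t|t|t|t].
  - by rewrite /kap; cont.
  - apply: (is_derive_eq (derD (derM (der_cst _ t) (dx t)) (derM (der_cst _ t) (dy t)))).
    by rewrite field_x field_y fE /lc /mc; field.
  - apply: (is_derive_eq (derD (derM (der_cst _ t) (dx t)) (derM (der_cst _ t) (dy t)))).
    by rewrite field_x field_y fE /lc /mc; field.
  - apply: (is_derive_eq (dz t)).
    by rewrite field_z// !sqr_coords.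
  - exact/torusE.
have tc := in_frame_torus sol.
split=> // t; apply/is_derive_rowP => i; rewrite mxE.
have [_ dl dm dz _] := sol.
case: (ord3P i) => ->.
- rewrite (_ : (fun s => c s 0 ix) = (fun s => mc theta (c s) * cos theta
    + - (lc theta (c s) * sin theta))); last by apply/funext => s; exact: coord_x.
  apply: (is_derive_eq (derD (derM (dm t) (der_cst _ t))
    (derN (derM (dl t) (der_cst _ t))))).
  rewrite field_x fE (coord_x theta (c t)) (coord_y theta (c t)).
  by field.
- rewrite (_ : (fun s => c s 0 iy) = (fun s => mc theta (c s) * sin theta
    + lc theta (c s) * cos theta)); last by apply/funext => s; exact: coord_y.
  apply: (is_derive_eq (derD (derM (dm t) (der_cst _ t)) (derM (dl t) (der_cst _ t)))).
  rewrite field_y fE (coord_x theta (c t)) (coord_y theta (c t)).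
  by field.
- apply: (is_derive_eq (dz t)).
  by rewrite field_z// !sqr_coords.
Qed.

End Frame.

(** The origin of [al] and [be]: the latter is 0 exactly when the planes coincide, if [c != 0]. *)
Lemma product_frame c theta theta' :
  (forall p, peval f p = c * lc theta p * lc theta' p) -> forall p,
  peval f p = lc theta p * (c * cos (theta - theta') * lc theta p
    + c * sin (theta - theta') * mc theta p).
Proof. by move=> fE p; rewrite fE (lc_frame theta theta'); ring. Qed.

(** The equivalence concerns all real angles, not only the listed ones. f vanishes on the plane of
    [theta], which is therefore that of [t1] or [t2], with a form differing by a nonzero
    constant. *)
Lemma invariant_meridian_product c t1 t2 theta : c != 0 ->
  (forall p, peval f p = c * lc t1 p * lc t2 p) -> invariant_meridian chi theta ->
  exists c' theta', c' != 0 /\ forall p, peval f p = c' * lc theta p * lc theta' p.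
Proof.
move=> c0 fE /(invariant_meridian_plane chiP chiQ) h.
have cos0 u : sin u = 0 -> cos u != 0.
  move=> s0; apply/eqP => cu; have := cos2Dsin2 u.
  by rewrite s0 cu expr0n addr0 => /eqP; rewrite eq_sym oner_eq0.
have := h (pt theta 0 1 0).
rewrite lc_pt mc_pt ptz mulr0 mulr1 => /(_ erefl)/esym/eqP.
rewrite fE (lc_frame theta t1) (lc_frame theta t2) lc_pt mc_pt !mulr0 !add0r !mulr1.
rewrite !mulf_eq0 (negbTE c0) /= => /orP[] /eqP s0.
  exists (c * cos (theta - t1)), t2; split; first by rewrite mulf_neq0 ?cos0.
  by move=> p; rewrite fE (lc_frame theta t1) s0 mul0r addr0; ring.
exists (c * cos (theta - t2)), t1; split; first by rewrite mulf_neq0 ?cos0.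
by move=> p; rewrite fE (lc_frame theta t2) s0 mul0r addr0; ring.
Qed.

Lemma limit_cycle_iff c theta theta' : c != 0 ->
  (forall p, peval f p = c * lc theta p * lc theta' p) ->
  limit_cycle a chi (meridian a theta) <->
  forall p, meridian a theta p -> peval K' p <> 0.
Proof.
move=> c0 /product_frame/trajectory_in_frame trajE; split=> [[per _] p Gp|h].
  by rewrite K'E; exact: periodic_meridian_factor trajE per p Gp.
apply: (meridian_limit_cycle a1 trajE); last by move=> p /h; rewrite K'E.
have [s0|s0] := eqVneq (sin (theta - theta')) 0.
  left; rewrite mulf_neq0//; apply/eqP => cu; have := cos2Dsin2 (theta - theta').
  by rewrite s0 cu expr0n addr0 => /eqP; rewrite eq_sym oner_eq0.
by right; rewrite mulf_neq0.
Qed.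

(** For distinct planes [be = c * sin (theta - theta')] has the sign of [- c]; for equal ones
    [al = c], seen from the side [l <= 0]. Both cases give the same verdict, the opposite of that
    for the last copy. *)
Lemma first_copy_stability c theta theta' (D : set 'rV[R]_3) : c != 0 ->
  (forall p, peval f p = c * lc theta p * lc theta' p) ->
  0 < sin (theta' - theta) \/
    (theta = theta' /\ forall p, D p -> lc theta p <= 0) ->
  limit_cycle a chi (meridian a theta) ->
  if c < 0 then stable_within a chi D (meridian a theta)
  else unstable_within a chi D (meridian a theta).
Proof.
move=> c0 /product_frame/trajectory_in_frame trajE side [per _].
have kap0 := periodic_meridian_factor trajE per.
move: c0; have [cneg|cpos|//] := ltgtP c 0 => _.
  apply: (meridian_stable a1 trajE) => //; case: side => [s0|[<- hD]].
    by left; rewrite -opprB sinN mulrN -mulNr mulr_gt0// oppr_gt0.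
  right; rewrite subrr sin0 cos0 mulr0 mulr1; split=> //; first by rewrite lt_eqF.
  by move=> p /hD lp; rewrite mulr_le0// ltW.
apply: (meridian_unstable a1 trajE) => //; case: side => [s0|[<- hD]].
  by left; rewrite -opprB sinN mulrN oppr_lt0 mulr_gt0.
right; rewrite subrr sin0 cos0 mulr0 mulr1; split=> //; first by rewrite gt_eqF.
by move=> p /hD lp; rewrite mulr_ge0_le0// ltW.
Qed.

Lemma last_copy_stability c theta theta' (D : set 'rV[R]_3) : c != 0 ->
  (forall p, peval f p = c * lc theta p * lc theta' p) ->
  0 < sin (theta - theta') \/
    (theta = theta' /\ forall p, D p -> 0 <= lc theta p) ->
  limit_cycle a chi (meridian a theta) ->
  if c < 0 then unstable_within a chi D (meridian a theta)
  else stable_within a chi D (meridian a theta).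
Proof.
move=> c0 /product_frame/trajectory_in_frame trajE side [per _].
have kap0 := periodic_meridian_factor trajE per.
move: c0; have [cneg|cpos|//] := ltgtP c 0 => _.
  apply: (meridian_unstable a1 trajE) => //; case: side => [s0|[<- hD]].
    by left; rewrite nmulr_rlt0.
  right; rewrite subrr sin0 cos0 mulr0 mulr1; split=> //; first by rewrite lt_eqF.
  by move=> p /hD lp; rewrite mulr_le0_ge0// ltW.
apply: (meridian_stable a1 trajE) => //; case: side => [s0|[<- hD]].
  by left; rewrite mulr_gt0.
right; rewrite subrr sin0 cos0 mulr0 mulr1; split=> //; first by rewrite gt_eqF.
by move=> p /hD lp; rewrite mulr_ge0// ltW.
Qed.

(** Adding [pi] to both angles changes the sign of both forms and keeps [c], so the last two entries
    repeat the labels of the first two. *)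
Lemma four_alternately_stable t1 t2 c : c != 0 -> t1 <= t2 -> t2 < t1 + pi ->
  (forall p, peval f p = c * lc t1 p * lc t2 p) ->
  alternately_stable a chi [:: t1; t2; t1 + pi; t2 + pi].
Proof.
move=> c0 le12 lt21 fE; split=> //; exists (c < 0).
have fE' p : peval f p = c * lc t2 p * lc t1 p by rewrite fE mulrAC.
have fEpi p : peval f p = c * lc (t1 + pi) p * lc (t2 + pi) p.
  by rewrite fE !lcDpi; ring.
have fEpi' p : peval f p = c * lc (t2 + pi) p * lc (t1 + pi) p.
  by rewrite fEpi mulrAC.
have diff : 0 < sin (t2 - t1) \/ t1 = t2.
  move: le12; rewrite le_eqVlt => /predU1P[->|lt12]; first by right.
  by left; rewrite sin_gt0_pi//; lra.
have dpi : t2 + pi - (t1 + pi) = t2 - t1 by ring.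
case=> [|[|[|[|//]]]] _ /= lim; rewrite ?addbF ?addbT.
- apply: (first_copy_stability c0 fE) lim.
  case: diff => [|e]; [by left|right; split=> // p [_ /=]].
  by rewrite peval_angle_form; apply; rewrite e !inE eqxx.
- rewrite if_neg; apply: (last_copy_stability c0 fE') lim.
  case: diff => [|e]; [by left|right; split=> // p [/= + _]].
  by rewrite peval_angle_form; apply; rewrite e !inE eqxx.
- apply: (first_copy_stability c0 fEpi) lim; rewrite dpi.
  case: diff => [|e]; [by left|right; split=> [|p [_ /=]]]; first by rewrite e.
  by rewrite peval_angle_form; apply; rewrite e !inE eqxx.
- rewrite if_neg; apply: (last_copy_stability c0 fEpi') lim; rewrite dpi.
  case: diff => [|e]; [by left|right; split=> [|p [/= + _]]]; first by rewrite e.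
  by rewrite peval_angle_form; apply; rewrite e !inE eqxx !orbT.
Qed.

End Assembly.

Unset Implicit Arguments.

Theorem theorem2p4 (R : realType) (a : R) (ha : 1 < a)
  (f K K' : mpoly 3 R) (beta gamma : R)
  (hK : K = K' * vz R)
  (hdegf : (pdegree f <= 2)%N) (hdegK : (pdegree K <= 2)%N)
  (P Q S : mpoly 3 R)
  (hP : P = 4^-1 *: (K * vx R) + f * vy R + beta *: vz R)
  (hQ : Q = 4^-1 *: (K * vy R) - f * vx R + gamma *: vz R)
  (hS : S = 2^-1 *: (K' * (- (a ^+ 2 *: (vx R ^+ 2 + vy R ^+ 2)) + vz R ^+ 2
                           + mpolyC 3 (a ^+ 4) - 1))
            - 2 *: ((beta *: vx R + gamma *: vy R)
                    * (vx R ^+ 2 + vy R ^+ 2 - mpolyC 3 (a ^+ 2))))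
  (chi : 3.-tuple (mpoly 3 R)) (hchi : chi = [tuple P; Q; S])
  (hcubic : field_degree chi = 3%N)
  (htorus : field_on_torus a chi)
  (ts : seq R) (hts : lists_invariant_meridians chi ts)
  (hfour : size ts = 4%N) :
  ((forall theta, invariant_meridian chi theta ->
      limit_cycle a chi (meridian a theta))
   <-> (forall theta, invariant_meridian chi theta ->
          forall p, meridian a theta p -> peval K' p <> 0))
  /\ alternately_stable a chi ts.
Proof.
move: hts {hcubic htorus}; rewrite {}hchi => hts.
have [t1 [t2 [c [-> [t12 t21] c0 [b0 g0] fE]]]] :=
  four_meridians hdegf hP hQ hts hfour.
have hdegK' : (pdegree K' <= 1)%N by apply: pdegree_mul_vz; rewrite -hK.
have [k0 [k1 [k2 [k3 K'E]]]] := degree1_affine hdegK'.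
have iff theta : invariant_meridian [tuple P; Q; S] theta ->
    limit_cycle a [tuple P; Q; S] (meridian a theta) <->
    forall p, meridian a theta p -> peval K' p <> 0.
  move=> /(invariant_meridian_product hP hQ c0 fE)[c' [theta' [c'0 fE']]].
  exact (limit_cycle_iff ha hK hP hQ hS b0 g0 K'E c'0 fE').
split; last exact (four_alternately_stable ha hK hP hQ hS b0 g0 K'E c0 t12 t21 fE).
by split=> h theta inv; apply/iff => //; exact: h.
Qed.
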